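(* For any Q-net of constant mean curvature in $\mathbb{R}^3$ or $\mathbb{S}^3$, or minimal in $\mathbb{S}^3$, there exists a Lax pair $(\mathcal U(\lambda),\mathcal V(\lambda))$ on $\mathbb{Z}^2$, with a frame $\Phi$, such that the corresponding immersion formula holds: (i) for a Q-net $(\hat F,\hat N)$ of constant mean curvature in $\mathbb{R}^3$, normalized by scaling to mean curvature $1$, $$\hat N=-\Phi^{-1}\mathbf k\,\Phi,\qquad \hat F=-\Phi^{-1}\frac{\partial\Phi}{\partial\gamma}-\frac12\hat N\qquad\text{evaluated at }\lambda=e^{i\gamma},\ \gamma=0;$$ (ii) for a Q-net $(F,N)$ in $\mathbb{S}^3$ of constant mean curvature $H$, or minimal ($H=0$), with $\gamma_1=-\gamma_2=\frac12\operatorname{arccot}H\in[0,\frac\pi2]$ ($\gamma_1=\frac\pi4$ if $H=0$), $\lambda_1=e^{i\gamma_1}$, $\lambda_2=e^{i\gamma_2}$ and $\mathbf M=\exp(\frac{\gamma_1-\gamma_2}{2}\mathbf k)$, $$F=\Phi(\lambda_1)^{-1}\mathbf M\,\Phi(\lambda_2),\qquad N=-\Phi(\lambda_1)^{-1}\mathbf k\,\mathbf M\,\Phi(\lambda_2).$$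
   Context: Notation. For a function $f$ on $\mathbb{Z}^2$, $f,f_1,f_2,f_{12}$ denote its values at $(m,n),(m+1,n),(m,n+1),(m+1,n+1)$; faces are the quadruples $(f,f_1,f_{12},f_2)$. Quaternions are represented by complex $2\times2$ matrices with $$\mathbf i=\begin{pmatrix}0&-i\\-i&0\end{pmatrix},\ \mathbf j=\begin{pmatrix}0&-1\\1&0\end{pmatrix},\ \mathbf k=\begin{pmatrix}-i&0\\0&i\end{pmatrix},\ \mathbf 1=\begin{pmatrix}1&0\\0&1\end{pmatrix};$$ $(X_1,X_2,X_3,X_4)\in\mathbb{R}^4$ corresponds to $X_1\mathbf i+X_2\mathbf j+X_3\mathbf k+X_4\mathbf 1$, $\mathbb{R}^3$ to imaginary quaternions ($X_4=0$), and $\mathbb{S}^3$ to unit quaternions, i.e. $SU(2)$. Q-nets. A Q-net (with Gauss map) is a pair $(F,N)$ of maps on $\mathbb{Z}^2$ with planar faces that are edge-parallel (corresponding edges of $F$ and $N$ are parallel), where either $F$ lies in $\mathbb{R}^3$ and $N$ in $\mathbb{S}^2$, or $F$ and $N$ lie in $\mathbb{S}^3$ and $F\perp N$ at each vertex. Faces are then circular. With $\mathcal A$ the area of planar quads (a quadratic form) and $\mathcal A(f,f')=\frac14(\mathcal A(f+f')-\mathcal A(f-f'))$ the mixed area of edge-parallel quads, the mean curvature of a face is $H_f=-\mathcal A(F(f),N(f))/\mathcal A(F(f))$. The net has constant mean curvature $H\ne0$ if $H_f=H$ on all faces; it is minimal if $H_f=0$ on all faces. Lax pair. To every edge $((m,n),(m+1,n))$,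 resp. $((m,n),(m,n+1))$, is attached a matrix $$\mathcal U(\lambda)=\frac1{\alpha(\lambda)}\begin{pmatrix}a&-\lambda u-\lambda^{-1}u^{-1}\\ \lambda u^{-1}+\lambda^{-1}u&\bar a\end{pmatrix},\ \text{ resp. }\ \mathcal V(\lambda)=\frac1{\beta(\lambda)}\begin{pmatrix}b&-i\lambda v+i\lambda^{-1}v^{-1}\\ i\lambda v^{-1}-i\lambda^{-1}v&\bar b\end{pmatrix},\quad|\lambda|=1,$$ with $a,b$ complex and $u,v>0$ independent of $\lambda$, and $\alpha(\lambda),\beta(\lambda)$ real such that the determinants equal $1$. The functions $\alpha$ and $\beta$ coincide on opposite edges of each face, and on each face $\mathcal V'(\lambda)\,\mathcal U(\lambda)=\mathcal U'(\lambda)\,\mathcal V(\lambda)$, where $\mathcal U,\mathcal V$ belong to the edges from vertex $0$ to $1$ and from $0$ to $2$ and $\mathcal U',\mathcal V'$ to the opposite edges (from $2$ to $12$ and from $1$ to $12$). A frame is a map $\Phi$ from $\mathbb{Z}^2$ into the loops $\lambda\mapsto\Phi(\lambda)\in SU(2)$, $|\lambda|=1$, with $\Phi(-\lambda)=\sigma_3\Phi(\lambda)\sigma_3$, $\sigma_3=\mathrm{diag}(1,-1)$, such that $\Phi_1=\mathcal U\Phi$, $\Phi_2=\mathcal V\Phi$.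
   Formalization: Proved for nets with embedded faces, not on a round sphere (N+HF nonconstant), with no edge joining F to its parallel net, and dF orthogonal to N on edges of R^3 nets where N is constant; the two lattice directions may need exchanging. The conclusion fails otherwise. *)

(* Defs.v *)
From HB Require Import structures.
From mathcomp Require Export all_boot all_order all_algebra.
From mathcomp Require Export spectral.
From mathcomp Require Export all_classical all_reals all_analysis.
From mathcomp Require Export complex.

Set Implicit Arguments.
Unset Strict Implicit.
Unset Printing Implicit Defensive.

Import Order.TTheory GRing.Theory Num.Theory numFieldNormedType.Exports.
Local Open Scope ring_scope.

Section Geometry.
Variable R : realType.

(* R^4 is identified with the quaternions, (X1,X2,X3,X4) being
   X1 i + X2 j + X3 k + X4 1; hence R^3 is the hyperplane X4 = 0. *)
Local Notation E4 := 'rV[R]_4.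
Local Notation net := (int -> int -> E4).

Definition dot (x y : E4) : R := \sum_i x 0 i * y 0 i.

Definition imaginary (x : E4) : Prop := x 0 3 = 0.

Definition parallel (x y : E4) : Prop :=
  exists s t : R, (s != 0) || (t != 0) /\ s *: x = t *: y.

Definition dm (f : net) m n : E4 := f (m + 1) n - f m n.
Definition dn (f : net) m n : E4 := f m (n + 1) - f m n.

Definition orthonormal2 (e1 e2 : E4) : Prop :=
  [/\ dot e1 e1 = 1, dot e2 e2 = 1 & dot e1 e2 = 0].

Definition in_span2 (e1 e2 x : E4) : Prop := exists s t : R, x = s *: e1 + t *: e2.

(* The face of f at (m,n) is planar, with plane directed by e1, e2. *)
Definition face_in (e1 e2 : E4) (f : net) m n : Prop :=
  [/\ in_span2 e1 e2 (f (m + 1) n - f m n),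
      in_span2 e1 e2 (f (m + 1) (n + 1) - f m n) &
      in_span2 e1 e2 (f m (n + 1) - f m n)].

Definition planar_face (f : net) m n : Prop :=
  exists e1 e2, orthonormal2 e1 e2 /\ face_in e1 e2 f m n.

(* Oriented area, with respect to the orthonormal frame (e1,e2) of the plane,
   of the quad (f, f_1, f_12, f_2): half the determinant of its diagonals. *)
Definition area (e1 e2 : E4) (f : net) m n : R :=
  let p := f (m + 1) (n + 1) - f m n in
  let q := f m (n + 1) - f (m + 1) n in
  2^-1 * (dot p e1 * dot q e2 - dot p e2 * dot q e1).

Definition mixed_area (e1 e2 : E4) (f g : net) m n : R :=
  4^-1 * (area e1 e2 (fun i j => f i j + g i j) m n
          - area e1 e2 (fun i j => f i j - g i j) m n).

(* Edge-parallel faces lie in parallel planes, so that (e1,e2) may be chosen in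
   common; reversing its orientation changes the sign of both areas. *)
Definition face_mean_curvature (F N : net) m n (H : R) : Prop :=
  exists e1 e2,
    [/\ orthonormal2 e1 e2, face_in e1 e2 F m n, face_in e1 e2 N m n,
        area e1 e2 F m n != 0 &
        H = - mixed_area e1 e2 F N m n / area e1 e2 F m n].

Definition const_mean_curvature (F N : net) (H : R) : Prop :=
  forall m n, face_mean_curvature F N m n H.

Definition edge_parallel (F N : net) : Prop :=
  forall m n, parallel (dm F m n) (dm N m n) /\ parallel (dn F m n) (dn N m n).

Definition planar_faces (f : net) : Prop := forall m n, planar_face f m n.

(* If N_1 <> N, the vector F_1 - F, being parallel to N_1 - N, is orthogonal to
   N + N_1. The last condition keeps this for an edge on which N is constant,
   where parallelism with the zero vector is void (e.g. along the rulings of a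
   cylinder). In S^3 it follows from F \perp N. *)
Definition qnet_R3 (F N : net) : Prop :=
  [/\ forall m n, [/\ imaginary (F m n), imaginary (N m n) & dot (N m n) (N m n) = 1],
      planar_faces F, planar_faces N, edge_parallel F N &
      forall m n,
        (dm N m n = 0 -> dot (dm F m n) (N m n) = 0) /\
        (dn N m n = 0 -> dot (dn F m n) (N m n) = 0)].

Definition qnet_S3 (F N : net) : Prop :=
  [/\ forall m n, [/\ dot (F m n) (F m n) = 1, dot (N m n) (N m n) = 1 &
                      dot (F m n) (N m n) = 0],
      planar_faces F, planar_faces N & edge_parallel F N].

(* The diagonals cross in an interior point and are not collinear. As faces are
   circular, this says that they are embedded quads with distinct vertices. *)
Definition embedded_faces (F : net) : Prop :=
  forall m n,
    ~ parallel (F (m + 1) (n + 1) - F m n) (F m (n + 1) - F (m + 1) n) /\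
    exists s t : R, [/\ 0 < s < 1, 0 < t < 1 &
      (1 - s) *: F m n + s *: F (m + 1) (n + 1)
      = (1 - t) *: F (m + 1) n + t *: F m (n + 1)].

(* N + H F is, up to scaling, the parallel net of the same kind; it is the
   Christoffel dual of F. It is constant exactly when the net lies on a round
   sphere of mean curvature H, all principal curvatures being equal to H. *)
Definition cm_dual (F N : net) (H : R) : net := fun m n => N m n + H *: F m n.

Definition non_umbilic (F N : net) (H : R) : Prop :=
  ~ (forall m n, cm_dual F N H m n = cm_dual F N H 0 0).

(* No edge joins F to the corresponding point of its parallel net. On such an
   edge a = 0, u = 1 (resp. b = 0, v = 1), so that the matrix to be divided by
   alpha (resp. beta) vanishes at lambda = i (resp. lambda = 1). *)
Definition edges_off_dual_R3 (F N : net) (H : R) : Prop :=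
  forall m n, H *: F (m + 1) n <> cm_dual F N H m n /\
              H *: F m (n + 1) <> cm_dual F N H m n.

Definition edges_off_dual_S3 (F N : net) (H : R) : Prop :=
  forall m n (c : R), F (m + 1) n <> c *: cm_dual F N H m n /\
                      F m (n + 1) <> c *: cm_dual F N H m n.

(* With N_1 - N = - kappa (F_1 - F), the form of the Lax matrices (u, v > 0)
   forces kappa > H on the edges (m,n)-(m+1,n) and kappa < H on the edges
   (m,n)-(m,n+1). A net has one of the two signs in each direction, so which
   curvature line direction is the first one is part of the labelling by Z^2. *)
Definition transpose_if (b : bool) (f : net) : net :=
  if b then fun m n => f n m else f.

End Geometry.

Section LaxPair.
Variable R : realType.
Local Notation C := R[i].
Local Open Scope complex_scope.

Definition mx2 (a b c d : C) : 'M[C]_2 :=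
  \matrix_(i, j) if i == 0 then (if j == 0 then a else b)
                 else (if j == 0 then c else d).

Definition qi : 'M[C]_2 := mx2 0 (- 'i%C) (- 'i%C) 0.
Definition qj : 'M[C]_2 := mx2 0 (- 1) 1 0.
Definition qk : 'M[C]_2 := mx2 (- 'i%C) 0 0 'i%C.
Definition sigma3 : 'M[C]_2 := mx2 1 0 0 (- 1).

Definition quat (x : 'rV[R]_4) : 'M[C]_2 :=
  (x 0 0)%:C *: qi + (x 0 1)%:C *: qj + (x 0 2)%:C *: qk + (x 0 3)%:C *: 1%:M.

Definition SU2 (A : 'M[C]_2) : Prop := A \is unitarymx /\ \det A = 1.

(* Edge data: la, lu, lalpha at (m,n) belong to the edge from (m,n) to (m+1,n);
   lb, lv, lbeta at (m,n) to the edge from (m,n) to (m,n+1). *)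
Record lax_data := LaxData {
  la : int -> int -> C;
  lb : int -> int -> C;
  lu : int -> int -> R;
  lv : int -> int -> R;
  lalpha : int -> int -> C -> R;
  lbeta : int -> int -> C -> R }.

Definition laxU (L : lax_data) m n (z : C) : 'M[C]_2 :=
  let a := la L m n in let u := (lu L m n)%:C in
  ((lalpha L m n z)%:C)^-1 *:
    mx2 a (- (z * u) - z^-1 * u^-1)
        (z * u^-1 + z^-1 * u) (Num.conj a).

Definition laxV (L : lax_data) m n (z : C) : 'M[C]_2 :=
  let b := lb L m n in let v := (lv L m n)%:C in
  ((lbeta L m n z)%:C)^-1 *:
    mx2 b (- ('i%C * z * v) + 'i%C * z^-1 * v^-1)
        ('i%C * z * v^-1 - 'i%C * z^-1 * v) (Num.conj b).

Definition lax_pair (L : lax_data) : Prop :=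
  forall m n, [/\ 0 < lu L m n, 0 < lv L m n &
    forall z : C, `|z| = 1 ->
      [/\ \det (laxU L m n z) = 1, \det (laxV L m n z) = 1,
          lalpha L m (n + 1) z = lalpha L m n z,
          lbeta L (m + 1) n z = lbeta L m n z &
          laxV L (m + 1) n z *m laxU L m n z
          = laxU L m (n + 1) z *m laxV L m n z]].

Definition cis (g : R) : C := cos g +i* sin g.

Definition mx_derivable (M : R -> 'M[C]_2) (g : R) : Prop :=
  forall i j, derivable (fun t : R => complex.Re (M t i j)) g 1 /\
              derivable (fun t : R => complex.Im (M t i j)) g 1.

Definition mx_derive (M : R -> 'M[C]_2) (g : R) : 'M[C]_2 :=
  \matrix_(i, j) (derive1 (fun t : R => complex.Re (M t i j)) g
                  +i* derive1 (fun t : R => complex.Im (M t i j)) g).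

(* Loops are differentiable functions of gamma, where lambda = exp(i gamma). *)
Definition frame (L : lax_data) (Phi : int -> int -> C -> 'M[C]_2) : Prop :=
  forall m n,
    (forall g : R, mx_derivable (fun t => Phi m n (cis t)) g) /\
    forall z : C, `|z| = 1 ->
      [/\ SU2 (Phi m n z),
          Phi m n (- z) = sigma3 *m Phi m n z *m sigma3,
          Phi (m + 1) n z = laxU L m n z *m Phi m n z &
          Phi m (n + 1) z = laxV L m n z *m Phi m n z].

Definition arccot (x : R) : R := pi / 2 - atan x.

(* exp (t k) = cos t 1 + sin t k, since k^2 = -1. *)
Definition exp_qk (t : R) : 'M[C]_2 := (cos t)%:C *: 1%:M + (sin t)%:C *: qk.

Definition immersion_R3 (F N : int -> int -> 'rV[R]_4)
    (Phi : int -> int -> C -> 'M[C]_2) : Prop :=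
  forall m n,
    let P0 := Phi m n (cis 0) in
    let dP0 := mx_derive (fun g => Phi m n (cis g)) 0 in
    quat (N m n) = - (invmx P0 *m qk *m P0) /\
    quat (F m n) = - (invmx P0 *m dP0) - 2^-1 *: quat (N m n).

Definition immersion_S3 (H : R) (F N : int -> int -> 'rV[R]_4)
    (Phi : int -> int -> C -> 'M[C]_2) : Prop :=
  let g1 := arccot H / 2 in
  let g2 := - g1 in
  let M := exp_qk ((g1 - g2) / 2) in
  forall m n,
    quat (F m n) = invmx (Phi m n (cis g1)) *m M *m Phi m n (cis g2) /\
    quat (N m n) = - (invmx (Phi m n (cis g1)) *m qk *m M *m Phi m n (cis g2)).

End LaxPair.

(* Main.v *)
Require Import Defs.
From mathcomp Require Import ring lra.
Set Implicit Arguments.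
Unset Strict Implicit.
Unset Printing Implicit Defensive.
Import Order.TTheory GRing.Theory Num.Theory numFieldNormedType.Exports.
Local Open Scope ring_scope.

(* A net of constant mean curvature H and its Christoffel dual N + H F have
   vanishing mixed area, so on a face with crossing diagonals the ratios of
   their edges are determined up to one factor; closing the linear form
   < N, . > around the face then forces the face to be circular, hence the net
   to be isothermic. Both space forms are treated at once: S denotes F in S^3
   and the constant quaternion 1 in R^3, so that dS = eps dF with eps = 1, 0.
   The negative cross ratios of the faces allow one to integrate a spin frame
   (p, q) by
     p_1 = - i q conj(e), q_1 = i p e,   p_2 = j q conj(e), q_2 = - j p e
   along the edges of unit direction e. Then p S conj(q) and - p N conj(q) are
   constant equal to M and k M, and p_1 conj(p), q_1 conj(q) are the values of
   one Lax matrix at lambda_1 and lambda_2. The compatibility condition at all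
   lambda follows from its value at lambda_1 together with the closing of F, and
   the frame is obtained by integrating the Lax pair from a twisted loop with
   prescribed values (in R^3, prescribed 1-jet) at the origin. *)

(** * Quaternions as vectors of R^4 *)

(** Only lambda_1 and lambda_2 have a geometric meaning; at other lambda the Lax matrices are known
    through their Laurent form alone, so compatibility must be deduced from few values. In S^3 the
    angle satisfies cos 2 gamma_1 = H s and sin 2 gamma_1 = s with s = 1 / sqrt (1 + H^2). R^3 with
    H = 1 is the degenerate case gamma_1 = 0, where the second relation becomes sin 2 gamma_1 = eps
    s with eps = 0, s = 1: the two values merge, p = q, and the position of F survives only in the
    derivative in gamma. Dividing by alpha and beta requires the numerators to vanish nowhere on the
    unit circle. As quaternions they have four real components, and all four can vanish only on
    edges which the conditions [edges_off_dual_R3] and [edges_off_dual_S3] exclude. Real positive u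
    and v require curvature minus H to have a fixed sign in each direction. Non-umbilicity makes
    this difference non-zero, and the dual ratios carry its sign over the lattice. *)

Section Quaternion.
Variable R : realType.
Local Notation E4 := 'rV[R]_4.
Implicit Types x y z : E4.

(* The real part comes last in a vector and first in [mkq]. *)
Definition mkq (a b c d : R) : E4 := \row_i [:: b; c; d; a]`_i.
Definition qw x : R := x 0 3.
Definition qx x : R := x 0 0.
Definition qy x : R := x 0 1.
Definition qz x : R := x 0 2.

Lemma mkqE a b c d :
  (qw (mkq a b c d) = a) * (qx (mkq a b c d) = b) *
  (qy (mkq a b c d) = c) * (qz (mkq a b c d) = d).
Proof. by rewrite /qw /qx /qy /qz /mkq !mxE. Qed.

Lemma q_ext x y : qw x = qw y -> qx x = qx y -> qy x = qy y -> qz x = qz y ->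
  x = y.
Proof.
move=> e3 e0 e1 e2; apply/rowP; case=> [[|[|[|[|//]]]] k].
- by rewrite (_ : Ordinal k = 0) //; exact/val_inj.
- by rewrite (_ : Ordinal k = 1) //; exact/val_inj.
- by rewrite (_ : Ordinal k = 2) //; exact/val_inj.
- by rewrite (_ : Ordinal k = 3) //; exact/val_inj.
Qed.

Lemma dotE x y :
  dot x y = qx x * qx y + qy x * qy y + qz x * qz y + qw x * qw y.
Proof.
rewrite /dot !big_ord_recl big_ord0 addr0 !addrA.
by do !congr (_ + _); congr (x _ _ * y _ _); apply/val_inj.
Qed.

Definition qmul x y : E4 := mkq
  (qw x * qw y - qx x * qx y - qy x * qy y - qz x * qz y)
  (qw x * qx y + qx x * qw y + qy x * qz y - qz x * qy y)
  (qw x * qy y + qy x * qw y + qz x * qx y - qx x * qz y)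
  (qw x * qz y + qz x * qw y + qx x * qy y - qy x * qx y).

Definition qconj x : E4 := mkq (qw x) (- qx x) (- qy x) (- qz x).

Lemma qaddE x y : (qw (x + y) = qw x + qw y) * (qx (x + y) = qx x + qx y) *
  (qy (x + y) = qy x + qy y) * (qz (x + y) = qz x + qz y).
Proof. by rewrite /qw /qx /qy /qz !mxE. Qed.

Lemma qoppE x : (qw (- x) = - qw x) * (qx (- x) = - qx x) *
  (qy (- x) = - qy x) * (qz (- x) = - qz x).
Proof. by rewrite /qw /qx /qy /qz !mxE. Qed.

Lemma qscaleE a x : (qw (a *: x) = a * qw x) * (qx (a *: x) = a * qx x) *
  (qy (a *: x) = a * qy x) * (qz (a *: x) = a * qz x).
Proof. by rewrite /qw /qx /qy /qz !mxE. Qed.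

Lemma qzeroE : (qw (0 : E4) = 0) * (qx (0 : E4) = 0) * (qy (0 : E4) = 0) *
  (qz (0 : E4) = 0).
Proof. by rewrite /qw /qx /qy /qz !mxE. Qed.

Definition qE := (mkqE, qaddE, qoppE, qscaleE, qzeroE).

End Quaternion.

Ltac qexp := rewrite ?dotE; rewrite /qmul /qconj ?qE.
Ltac qring := apply: q_ext; qexp; ring.

(** * Quaternion algebra and its realization by complex matrices *)

Section QuaternionTheory.
Variable R : realType.
Local Notation E4 := 'rV[R]_4.
Implicit Types x y z : E4.

Definition q1 : E4 := mkq 1 0 0 0.

Lemma qmulA x y z : qmul x (qmul y z) = qmul (qmul x y) z.
Proof. qring. Qed.

Lemma qmul1 x : qmul q1 x = x.
Proof. rewrite /q1; qring. Qed.

Lemma qmulq1 x : qmul x q1 = x.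
Proof. rewrite /q1; qring. Qed.

Lemma qmulDl x y z : qmul (x + y) z = qmul x z + qmul y z.
Proof. qring. Qed.

Lemma qmulDr x y z : qmul x (y + z) = qmul x y + qmul x z.
Proof. qring. Qed.

Lemma qmulZl a x y : qmul (a *: x) y = a *: qmul x y.
Proof. qring. Qed.

Lemma qmulZr a x y : qmul x (a *: y) = a *: qmul x y.
Proof. qring. Qed.

Lemma qmulNl x y : qmul (- x) y = - qmul x y.
Proof. qring. Qed.

Lemma qmulNr x y : qmul x (- y) = - qmul x y.
Proof. qring. Qed.

Lemma qconjM x y : qconj (qmul x y) = qmul (qconj y) (qconj x).
Proof. qring. Qed.

Lemma qconjK x : qconj (qconj x) = x.
Proof. qring. Qed.

Lemma qconjZ a x : qconj (a *: x) = a *: qconj x.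
Proof. qring. Qed.

Lemma qmul_conj x : qmul x (qconj x) = dot x x *: q1.
Proof. rewrite /q1; qring. Qed.

Lemma qconj_mul x : qmul (qconj x) x = dot x x *: q1.
Proof. rewrite /q1; qring. Qed.

Lemma dot_conj x : dot (qconj x) (qconj x) = dot x x.
Proof. qexp; ring. Qed.

Lemma dot_qmul x y : dot (qmul x y) (qmul x y) = dot x x * dot y y.
Proof. qexp; ring. Qed.

Lemma dotZZ a x : dot (a *: x) (a *: x) = a ^+ 2 * dot x x.
Proof. qexp; ring. Qed.

Lemma dot_ge0 x : 0 <= dot x x.
Proof. by rewrite dotE -!expr2 !addr_ge0 ?sqr_ge0. Qed.

Lemma dot_eq0 x : dot x x = 0 -> x = 0.
Proof.
rewrite dotE -!expr2 => h.
have := sqr_ge0 (qx x); have := sqr_ge0 (qy x); have := sqr_ge0 (qz x).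
have := sqr_ge0 (qw x) => hw hz hy hx.
by apply: q_ext; rewrite qzeroE; apply/eqP; rewrite -sqrf_eq0; apply/eqP; lra.
Qed.

Lemma unit_mulK x y : dot x x = 1 -> qmul (qconj x) (qmul x y) = y.
Proof. by move=> h; rewrite qmulA qconj_mul h scale1r qmul1. Qed.

Lemma unit_mulVK x y : dot x x = 1 -> qmul x (qmul (qconj x) y) = y.
Proof. by move=> h; rewrite qmulA qmul_conj h scale1r qmul1. Qed.

Lemma unit_mulVKr x y : dot x x = 1 -> qmul (qmul y (qconj x)) x = y.
Proof. by move=> h; rewrite -qmulA qconj_mul h scale1r qmulq1. Qed.

(** Conjugation by k, hence by [sigma3] on matrices: it changes the sign of the off-diagonal
    entries. *)
Definition qtwist x : E4 := mkq (qw x) (- qx x) (- qy x) (qz x).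

Lemma qtwistM x y : qtwist (qmul x y) = qmul (qtwist x) (qtwist y).
Proof. rewrite /qtwist; qring. Qed.

Lemma dot_twist (x : E4) : dot (qtwist x) (qtwist x) = dot x x.
Proof. rewrite /qtwist; qexp; ring. Qed.

Lemma unit_mul_inj (x : E4) : dot x x = 1 -> injective (qmul x).
Proof. by move=> h; apply: can_inj (fun y => unit_mulK y h). Qed.

Lemma complex_ext (a b : R[i]) :
  complex.Re a = complex.Re b -> complex.Im a = complex.Im b -> a = b.
Proof. by case: a b => [a b] [c d] /= -> ->. Qed.

Lemma quatE x : quat x =
  mx2 (qw x -i* qz x)%C (- qy x -i* qx x)%C (qy x -i* qx x)%C (qw x +i* qz x)%C.
Proof.
apply/matrixP=> i j; rewrite /quat /qi /qj /qk !mxE /qw /qx /qy /qz.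
by case: i => [[|[|//]] ?]; case: j => [[|[|//]] ?] /=;
  rewrite ?mulr0 ?mulr1 ?add0r ?addr0 /=; apply/eqP; rewrite eq_complex; simpc;
  rewrite /= ?eqxx.
Qed.

Lemma quatM x y : quat (qmul x y) = quat x *m quat y.
Proof.
rewrite !quatE; apply/matrixP=> i j.
rewrite !mxE !big_ord_recl big_ord0 !mxE /=.
case: i => [[|[|//]] ?]; case: j => [[|[|//]] ?] /=; rewrite /qmul ?qE;
apply: complex_ext; rewrite /=; ring.
Qed.

Lemma quatZ a x : quat (a *: x) = a%:C%C *: quat x.
Proof.
rewrite !quatE; apply/matrixP=> i j; rewrite !mxE ?qE.
case: i => [[|[|//]] ?]; case: j => [[|[|//]] ?] /=;
apply: complex_ext; rewrite /=; ring.
Qed.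

Lemma quatD x y : quat (x + y) = quat x + quat y.
Proof.
rewrite !quatE; apply/matrixP=> i j; rewrite !mxE ?qE.
case: i => [[|[|//]] ?]; case: j => [[|[|//]] ?] /=;
apply: complex_ext; rewrite /=; ring.
Qed.

Lemma quatN x : quat (- x) = - quat x.
Proof. by rewrite -scaleN1r quatZ rmorphN1 scaleN1r. Qed.

Lemma quat1 : quat q1 = 1%:M.
Proof.
rewrite quatE /q1 ?qE; apply/matrixP=> i j; rewrite !mxE.
case: i => [[|[|//]] ?]; case: j => [[|[|//]] ?] /=;
apply/eqP; rewrite eq_complex; simpc; rewrite /= ?oppr0 ?eqxx //.
Qed.

Lemma det_quat x : \det (quat x) = (dot x x)%:C%C.
Proof.
rewrite quatE (expand_det_row _ 0) !big_ord_recl big_ord0 /cofactor !det_mx11.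
by rewrite !mxE /=; apply: complex_ext; rewrite ?dotE /=; ring.
Qed.

Lemma quat_twist x : quat (qtwist x) = sigma3 R *m quat x *m sigma3 R.
Proof.
rewrite !quatE /sigma3 /qtwist ?qE; apply/matrixP=> i j.
rewrite !mxE !big_ord_recl !big_ord0 !mxE /= !big_ord_recl !big_ord0 !mxE /=.
case: i => [[|[|//]] ?]; case: j => [[|[|//]] ?] /=;
apply: complex_ext; rewrite /=; ring.
Qed.

Lemma invmx_quat x : dot x x = 1 -> invmx (quat x) = quat (qconj x).
Proof.
move=> h; have e : quat x *m quat (qconj x) = 1%:M.
  by rewrite -quatM qmul_conj h scale1r quat1.
have U : quat x \in unitmx by rewrite unitmxE det_quat h unitr1.
by rewrite -[RHS](mulKmx U) e mulmx1.
Qed.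

Lemma quat_SU2 x : dot x x = 1 -> SU2 (quat x).
Proof.
move=> h; split; last by rewrite det_quat h.
apply/unitarymxP; rewrite -quat1 -[q1]scale1r -h -qmul_conj quatM; congr (_ *m _).
rewrite !quatE /qconj ?qE; apply/matrixP=> i j; rewrite !mxE.
by case: i => [[|[|//]] ?]; case: j => [[|[|//]] ?] /=;
apply/eqP; rewrite eq_complex /= ?opprK ?eqxx.
Qed.

End QuaternionTheory.

(** * Discrete integration on Z^2 *)

(** The step is an equivalence because negative indices are reached by undoing it; invertible edge
    maps provide both directions. *)
Lemma int_shift_ind (P : int -> Prop) :
  P 0 -> (forall m, P m <-> P (m + 1)) -> forall m, P m.
Proof.
move=> P0 PS; elim/int_rect => // n.
  by move/PS; rewrite -PoszD addn1.
by move=> h; apply/PS; rewrite (_ : - n.+1%:Z + 1 = - n%:Z) // -addn1 PoszD; ring.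
Qed.

Lemma int2_shift_ind (P : int -> int -> Prop) :
  P 0 0 -> (forall m n, P m n <-> P (m + 1) n) ->
  (forall m n, P m n <-> P m (n + 1)) -> forall m n, P m n.
Proof.
move=> P0 Pm Pn m; apply: int_shift_ind; last exact: Pn.
by move: m; apply: (int_shift_ind (P := P^~ 0)).
Qed.

Section Integration.
Variables (X : Type) (U U' V V' : int -> int -> X -> X) (x0 : X).
Hypothesis UK : forall m n, cancel (U m n) (U' m n).
Hypothesis UVK : forall m n, cancel (U' m n) (U m n).
Hypothesis VK : forall m n, cancel (V m n) (V' m n).
Hypothesis VVK : forall m n, cancel (V' m n) (V m n).
Hypothesis UV_comm : forall m n x,
  V (m + 1) n (U m n x) = U m (n + 1) (V m n x).

(** Edge maps are indexed by the lower endpoint, so the step from - k to - k - 1 inverts the map at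
    - k - 1, which is [Negz k]. *)
Definition int_iter (f g : int -> X -> X) (x : X) (m : int) : X :=
  match m with
  | Posz k => iteri k (fun i => f (Posz i)) x
  | Negz k => iteri k.+1 (fun i => g (Negz i)) x
  end.

Lemma int_iterS f g x m : (forall m, cancel (g m) (f m)) ->
  int_iter f g x (m + 1) = f m (int_iter f g x m).
Proof.
case: m => [k|[|k]] gK; first by rewrite -PoszD addn1.
  by rewrite /= gK.
rewrite (_ : Negz k.+1 + 1 = Negz k) /= ?gK //.
by rewrite !NegzE -addn1 PoszD; ring.
Qed.

(** Integration along the axis n = 0, then along the columns: the recursion in n is immediate, the
    one in m off the axis comes from commutation on the faces. *)
Definition grid (m n : int) : X :=
  int_iter (V m) (V' m) (int_iter (U^~ 0) (U'^~ 0) x0 m) n.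

Lemma grid_n m n : grid m (n + 1) = V m n (grid m n).
Proof. by rewrite /grid int_iterS. Qed.

Lemma grid_m m n : grid (m + 1) n = U m n (grid m n).
Proof.
move: n; apply: int_shift_ind => [|n]; first by rewrite /grid /= int_iterS.
rewrite !grid_n; split=> [->|h]; first exact: UV_comm.
by rewrite -[LHS](VK (m + 1) n) h -UV_comm VK.
Qed.

End Integration.

(** * Faces of constant mean curvature *)

Section Faces.
Variable R : realType.
Local Notation E4 := 'rV[R]_4.
Local Notation net := (int -> int -> E4).

Lemma dotDl (x y z : E4) : dot (x + y) z = dot x z + dot y z.
Proof. qexp; ring. Qed.
Lemma dotNl (x y : E4) : dot (- x) y = - dot x y.
Proof. qexp; ring. Qed.
Lemma dotZl a (x y : E4) : dot (a *: x) y = a * dot x y.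
Proof. qexp; ring. Qed.
Lemma dotC (x y : E4) : dot x y = dot y x.
Proof. qexp; ring. Qed.
Lemma dotDr (x y z : E4) : dot z (x + y) = dot z x + dot z y.
Proof. qexp; ring. Qed.
Lemma dotNr (x y : E4) : dot x (- y) = - dot x y.
Proof. qexp; ring. Qed.
Lemma dotZr a (x y : E4) : dot x (a *: y) = a * dot x y.
Proof. qexp; ring. Qed.
Definition dot_lin := (dotDl, dotNl, dotZl, dotDr, dotNr, dotZr).

(* The four edges of a quad in terms of its diagonals [d1], [d2], which cross
   at the parameters [s], [t]. *)
Definition edge01 (s t : R) (d1 d2 : E4) := s *: d1 - t *: d2.
Definition edge1_12 (s t : R) (d1 d2 : E4) := (1 - s) *: d1 + t *: d2.
Definition edge02 (s t : R) (d1 d2 : E4) := s *: d1 + (1 - t) *: d2.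
Definition edge2_12 (s t : R) (d1 d2 : E4) := (1 - s) *: d1 - (1 - t) *: d2.

(* Factors between the edges of a quad and those of an edge-parallel quad with
   which it has vanishing mixed area: [r1, r2, r3, r4] belong to the edges
   01, 1-12, 02, 2-12. They are those of the Christoffel dual. *)
Definition dual_ratios (s t r1 r2 r3 r4 : R) :=
  [/\ r3 * (1 - t) = - (r1 * t), r2 * (1 - s) = - (r1 * s) &
      r4 * ((1 - s) * (1 - t)) = r1 * (s * t)].

(** With [(P, P')] and [(Q, Q')] the coordinates of the diagonals, [X] and [Y] are the coefficients
    of the closing defect of the parallel quad with edge factors r1, ..., r4, and its mixed area
    with the given quad is a multiple of [Z * (P * Q' - P' * Q)]. The solution makes each diagonal
    of the parallel quad parallel to the other diagonal of the given one, which is Christoffel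
    duality of quads. *)
Lemma dual_ratiosP (s t P P' Q Q' r1 r2 r3 r4 : R) :
  0 < s < 1 -> 0 < t < 1 -> P * Q' - P' * Q != 0 ->
  let X := r1 * s + r2 * (1 - s) - r3 * s - r4 * (1 - s) in
  let Y := (r2 - r1) * t - (r3 - r4) * (1 - t) in
  let Z := r3 * (1 - t) + r1 * t + r1 * s + r2 * (1 - s) in
  X * P + Y * Q = 0 -> X * P' + Y * Q' = 0 -> Z * (P * Q' - P' * Q) = 0 ->
  dual_ratios s t r1 r2 r3 r4.
Proof.
move=> s01 t01 D0 X Y Z e1 e2 e3.
have X0 : X = 0.
  apply/(mulIf D0); rewrite mul0r -[RHS](_ : Q' * (X * P + Y * Q) - Q * (X * P' + Y * Q') = 0); first by ring.
  by rewrite e1 e2; ring.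
have Y0 : Y = 0.
  apply/(mulIf D0); rewrite mul0r -[RHS](_ : P * (X * P' + Y * Q') - P' * (X * P + Y * Q) = 0); first by ring.
  by rewrite e1 e2; ring.
have Z0 : Z = 0 by apply/(mulIf D0); rewrite mul0r.
move: X0 Y0 Z0; rewrite /X /Y /Z => X0 Y0 Z0.
have X1 := congr1 (fun a => a * (1 - t)) X0.
have E : r3 * (1 - t) = - (r1 * t).
  by have := congr1 (fun a => a * (1 - s)) Y0; lra.
have E2 : r2 * (1 - s) = - (r1 * s) by lra.
split=> //; have := congr1 (fun a => a * s) E.
by have := congr1 (fun a => a * (1 - t)) E2; lra.
Qed.

(** Mean curvature H amounts to vanishing mixed area of F and N + H F, whose edges are those of F
    times H minus the curvature. *)
Lemma face_dual_ratios (F N : net) m n (H s t k1 k2 k3 k4 : R) :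
  face_mean_curvature F N m n H -> 0 < s < 1 -> 0 < t < 1 ->
  (1 - s) *: F m n + s *: F (m + 1) (n + 1)
    = (1 - t) *: F (m + 1) n + t *: F m (n + 1) ->
  dm N m n = - k1 *: dm F m n -> dn N (m + 1) n = - k2 *: dn F (m + 1) n ->
  dn N m n = - k3 *: dn F m n -> dm N m (n + 1) = - k4 *: dm F m (n + 1) ->
  dual_ratios s t (H - k1) (H - k2) (H - k3) (H - k4).
Proof.
case=> e1 [e2 [_ _ _ + +]] s01 t01.
rewrite /mixed_area /area /dm /dn.
set A := F m n; set B := F (m + 1) n; set C := F (m + 1) (n + 1).
set D := F m (n + 1); set A' := N m n; set B' := N (m + 1) n.
set C' := N (m + 1) (n + 1); set D' := N m (n + 1).
rewrite !dot_lin => ar0 eH cr h1 h2 h3 h4.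
(* Products with [e1] and [e2] turn the vector relations into relations between plane
   coordinates. *)
have dt e : [/\ (1 - s) * dot A e + s * dot C e = (1 - t) * dot B e + t * dot D e,
  dot B' e - dot A' e = - k1 * (dot B e - dot A e),
  dot C' e - dot B' e = - k2 * (dot C e - dot B e),
  dot D' e - dot A' e = - k3 * (dot D e - dot A e) &
  dot C' e - dot D' e = - k4 * (dot C e - dot D e)].
  by split; [move/(congr1 (fun x => dot x e)): cr|move/(congr1 (fun x => dot x e)): h1|
    move/(congr1 (fun x => dot x e)): h2|move/(congr1 (fun x => dot x e)): h3|
    move/(congr1 (fun x => dot x e)): h4]; rewrite !dot_lin.
have [c1 a1 a2 a3 a4] := dt e1; have [c2 b1 b2 b3 b4] := dt e2.
move: eH ar0 c1 a1 a2 a3 a4 c2 b1 b2 b3 b4 => {dt}.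
move: (dot A e1) (dot B e1) (dot C e1) (dot D e1) => xA xB xC xD.
move: (dot A e2) (dot B e2) (dot C e2) (dot D e2) => yA yB yC yD.
move: (dot A' e1) (dot B' e1) (dot C' e1) (dot D' e1) => nA nB nC nD.
move: (dot A' e2) (dot B' e2) (dot C' e2) (dot D' e2) => mA mB mC mD.
move=> + ar0 c1 a1 a2 a3 a4 c2 b1 b2 b3 b4.
move/(congr1 (fun z => z * (2^-1 *
   ((xC - xA) * (yD - yB) - (yC - yA) * (xD - xB))))).
rewrite divfK // => eH.
have D0 : (xC - xA) * (yD - yB) - (yC - yA) * (xD - xB) != 0.
  by move: ar0; rewrite mulf_eq0 negb_or => /andP[_].
(* All coordinates are eliminated in favour of one vertex of each quad, the diagonals and the edge
   factors. *)
have [P eC] : exists P, xC = xA + P by exists (xC - xA); ring.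
have [P' eC'] : exists P, yC = yA + P by exists (yC - yA); ring.
have [Q eD] : exists Q, xD = xB + Q by exists (xD - xB); ring.
have [Q' eD'] : exists Q, yD = yB + Q by exists (yD - yB); ring.
subst xC yC xD yD.
have {c1} eB : xB = xA + (s * P - t * Q) by lra.
have {c2} eB' : yB = yA + (s * P' - t * Q') by lra.
subst xB yB.
have {a1} eB : nB = nA - k1 * (s * P - t * Q) by lra.
have {b1} eB' : mB = mA - k1 * (s * P' - t * Q') by lra.
have {a3} eD : nD = nA - k3 * (s * P + (1 - t) * Q) by lra.
have {b3} eD' : mD = mA - k3 * (s * P' + (1 - t) * Q') by lra.
subst nB mB nD mD.
have {a2} eC : nC = nA - k1 * (s * P - t * Q) - k2 * ((1 - s) * P + t * Q) by lra.
have {b2} eC' : mC = mA - k1 * (s * P' - t * Q') - k2 * ((1 - s) * P' + t * Q').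
  by lra.
subst nC mC.
have D1 : P * Q' - P' * Q != 0.
  by apply: contraNneq D0 => h; apply/eqP; rewrite -h; ring.
by apply: (dual_ratiosP s01 t01 D1); lra.
Qed.


End Faces.

(** * Circular quads: labels and cross ratios *)

Section CircularFaces.
Variable R : realType.
Local Notation E4 := 'rV[R]_4.

(* Closing the linear form [dot N0] around the face. *)
Lemma face_circular (s t H r1 r2 r3 r4 : R) (d1 d2 N0 : E4) :
  let f1 := edge01 s t d1 d2 in let f2 := edge1_12 s t d1 d2 in
  let f3 := edge02 s t d1 d2 in let f4 := edge2_12 s t d1 d2 in
  0 < s < 1 -> 0 < t < 1 -> r1 != 0 -> dual_ratios s t r1 r2 r3 r4 ->
  2 * dot N0 f1 = (H - r1) * dot f1 f1 ->
  2 * dot (N0 - (H - r1) *: f1) f2 = (H - r2) * dot f2 f2 ->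
  2 * dot N0 f3 = (H - r3) * dot f3 f3 ->
  2 * dot (N0 - (H - r3) *: f3) f4 = (H - r4) * dot f4 f4 ->
  s * (1 - s) * dot d1 d1 = t * (1 - t) * dot d2 d2.
Proof.
move=> f1 f2 f3 f4 s01 t01 r10 [e3 e2 e4].
have s1 : 1 - s != 0 by lra.
have t1 : 1 - t != 0 by lra.
have {}e2 : r2 = - (r1 * s) / (1 - s) by rewrite -e2 mulfK.
have {}e3 : r3 = - (r1 * t) / (1 - t) by rewrite -e3 mulfK.
have {}e4 : r4 = r1 * (s * t) / ((1 - s) * (1 - t)).
  by rewrite -e4 mulfK // mulf_neq0.
rewrite /f1 /f2 /f3 /f4 /edge01 /edge1_12 /edge02 /edge2_12 !dot_lin (dotC d2 d1).
move: (dot N0 d1) (dot N0 d2) (dot d1 d1) (dot d1 d2) (dot d2 d2).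
move=> n1 n2 A B C h1 h2 h3 h4; apply/eqP; rewrite -subr_eq0 -(mulrI_eq0 _ (lregP r10)).
apply/eqP; subst r2 r3 r4.
(* Both paths across the face compute twice the product of [N0] with [d1]. The terms in H are H
   times the squared length of [d1] on either side and cancel; what remains is [r1] times the
   difference of the two chord products. *)
have {h1 h2} h12 := congr2 (fun a b => a + b) h1 h2.
have {h3 h4} h34 := congr2 (fun a b => a + b) h3 h4.
have {h12 h34} := congr2 (fun a b => (1 - s) * (1 - t) * (a - b)) h12 h34.
move/eqP; rewrite -subr_eq0 => /eqP h.
by rewrite -[RHS]h; field; apply/andP; split.
Qed.

Variables (s t : R) (d1 d2 : E4).
Hypotheses (s01 : 0 < s < 1) (t01 : 0 < t < 1).
Hypothesis circ : s * (1 - s) * dot d1 d1 = t * (1 - t) * dot d2 d2.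
Let f1 := edge01 s t d1 d2.
Let f2 := edge1_12 s t d1 d2.
Let f3 := edge02 s t d1 d2.
Let f4 := edge2_12 s t d1 d2.

(** [circ] is the intersecting chords theorem. The triangles which the diagonals cut off at opposite
    edges are similar, so the squared ratios of opposite edges are s t / ((1 - s) (1 - t)) and s (1
    - t) / (t (1 - s)), the inverses of the corresponding dual ratios. *)
Lemma face_labels (r1 r2 r3 r4 : R) : dual_ratios s t r1 r2 r3 r4 ->
  [/\ r1 * dot f1 f1 = r4 * dot f4 f4, r3 * dot f3 f3 = r2 * dot f2 f2 &
      r1 * r4 = r2 * r3].
Proof.
move=> [e3 e2 e4].
move: (s01) (t01) => s01' t01'.
have s0 : s != 0 by lra.
have t0 : t != 0 by lra.
have s1 : 1 - s != 0 by lra.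
have t1 : 1 - t != 0 by lra.
have {}e2 : r2 = - (r1 * s) / (1 - s) by rewrite -e2 mulfK.
have {}e3 : r3 = - (r1 * t) / (1 - t) by rewrite -e3 mulfK.
have {}e4 : r4 = r1 * (s * t) / ((1 - s) * (1 - t)).
  by rewrite -e4 mulfK // mulf_neq0.
subst r2 r3 r4.
have dE : dot d1 d1 = t * (1 - t) * dot d2 d2 / (s * (1 - s)).
  by rewrite -circ mulrAC divff ?mul1r // mulf_neq0.
rewrite /f1 /f2 /f3 /f4 /edge01 /edge1_12 /edge02 /edge2_12 !dot_lin (dotC d2 d1).
by rewrite dE; split; field; rewrite ?s0 ?t0 ?s1 ?t1.
Qed.

Let w := qmul d1 (qconj d2) - dot d1 d2 *: q1 R.
Let w' := qmul (qconj d1) d2 - dot d1 d2 *: q1 R.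

(** The quaternionic cross ratio of an embedded circular quad is real and negative: the imaginary
    parts of the two products are [t *: w] and [- (1 - t) *: w], and [circ] puts the real parts in
    the same ratio. *)
Lemma face_cross_ratio :
  (1 - t) *: qmul f1 (qconj f2) = - t *: qmul f3 (qconj f4) /\
  (1 - t) *: qmul (qconj f1) f2 = - t *: qmul (qconj f3) f4.
Proof.
have e12 : qmul f1 (qconj f2) = (s * (1 - s) * dot d1 d1 - t ^+ 2 * dot d2 d2
    + t * (2 * s - 1) * dot d1 d2) *: q1 R + t *: w.
  rewrite /w /f1 /f2 /edge01 /edge1_12 /q1; qring.
have e34 : qmul f3 (qconj f4) = (s * (1 - s) * dot d1 d1
    - (1 - t) ^+ 2 * dot d2 d2 + (1 - t) * (1 - 2 * s) * dot d1 d2) *: q1 R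
    - (1 - t) *: w.
  rewrite /w /f3 /f4 /edge02 /edge2_12 /q1; qring.
have e12' : qmul (qconj f1) f2 = (s * (1 - s) * dot d1 d1 - t ^+ 2 * dot d2 d2
    + t * (2 * s - 1) * dot d1 d2) *: q1 R + t *: w'.
  rewrite /w' /f1 /f2 /edge01 /edge1_12 /q1; qring.
have e34' : qmul (qconj f3) f4 = (s * (1 - s) * dot d1 d1
    - (1 - t) ^+ 2 * dot d2 d2 + (1 - t) * (1 - 2 * s) * dot d1 d2) *: q1 R
    - (1 - t) *: w'.
  rewrite /w' /f3 /f4 /edge02 /edge2_12 /q1; qring.
rewrite e12 e34 e12' e34' circ.
move: (dot d2 d2) (dot d1 d2) w w' => C B W W'.
by split; apply: q_ext; rewrite ?qE; ring.
Qed.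

End CircularFaces.

(** * Lengths and unit directions *)

Section Directions.
Variable R : realType.
Local Notation E4 := 'rV[R]_4.
Implicit Types f x y : E4.

Definition qlen f : R := Num.sqrt (dot f f).
Definition qdir f : E4 := (qlen f)^-1 *: f.

Lemma qlen_gt0 f : f <> 0 -> 0 < qlen f.
Proof.
move=> f0; rewrite sqrtr_gt0 lt_neqAle dot_ge0 andbT eq_sym.
by apply/eqP => /dot_eq0.
Qed.

Lemma sqr_qlen f : qlen f ^+ 2 = dot f f.
Proof. by rewrite sqr_sqrtr // dot_ge0. Qed.

Lemma qlen_dir f : f <> 0 -> f = qlen f *: qdir f.
Proof.
by move=> /qlen_gt0 h; rewrite /qdir scalerA divff ?scale1r // gt_eqF.
Qed.

Lemma dot_qdir f : f <> 0 -> dot (qdir f) (qdir f) = 1.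
Proof.
move=> /qlen_gt0 h; rewrite /qdir dotZZ -sqr_qlen -exprMn mulVf ?expr1n //.
by rewrite gt_eqF.
Qed.

Lemma qlenM x y : qlen (qmul x y) = qlen x * qlen y.
Proof. by rewrite /qlen dot_qmul sqrtrM // dot_ge0. Qed.

Lemma qlenC x : qlen (qconj x) = qlen x.
Proof. by rewrite /qlen dot_conj. Qed.

Lemma qlenZ a x : 0 <= a -> qlen (a *: x) = a * qlen x.
Proof. by move=> a0; rewrite /qlen dotZZ sqrtrM ?sqr_ge0 // sqrtr_sqr ger0_norm. Qed.

Lemma qlenN x : qlen (- x) = qlen x.
Proof. by rewrite /qlen dotNl dotNr opprK. Qed.

(** Normalization keeps only the sign of a real factor, so a negative cross ratio becomes an exact
    relation between unit directions. *)
Lemma dir_opp t (x y : E4) : 0 < t < 1 -> y <> 0 ->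
  (1 - t) *: x = - t *: y -> qdir x = - qdir y.
Proof.
move=> t01 /qlen_gt0 y0 e.
have t1 : 1 - t != 0 by lra.
have l : (1 - t) * qlen x = t * qlen y.
  by rewrite -!qlenZ ?e ?scaleNr ?qlenN; lra.
have xE : x = (1 - t)^-1 *: (- t *: y) by rewrite -e scalerA mulVf ?scale1r.
have lE : qlen x = (1 - t)^-1 * (t * qlen y) by rewrite -l mulrA mulVf ?mul1r.
rewrite /qdir lE {1}xE !scalerA -scaleNr; congr (_ *: _).
by field; rewrite t1 gt_eqF //= gt_eqF //; lra.
Qed.

Lemma qdirM x y : qdir (qmul x y) = qmul (qdir x) (qdir y).
Proof. by rewrite /qdir qlenM qmulZl qmulZr scalerA invfM. Qed.

Lemma qdirC x : qdir (qconj x) = qconj (qdir x).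
Proof. by rewrite /qdir qlenC qconjZ. Qed.

Lemma qmul_neq0 x y : x <> 0 -> y <> 0 -> qmul x y <> 0.
Proof.
have l0 : qlen (0 : E4) = 0 by rewrite /qlen -(scale0r 0) dotZl mul0r sqrtr0.
move=> /qlen_gt0 x0 /qlen_gt0 y0 /(congr1 qlen); rewrite qlenM l0 => /eqP.
by rewrite mulf_eq0 !gt_eqF.
Qed.

Lemma qconj_neq0 x : x <> 0 -> qconj x <> 0.
Proof. by move=> h e; apply: h; rewrite -[x]qconjK e; qring. Qed.

End Directions.

(** * From curvature to isothermic edge labels *)

Section Isothermic.
Variable R : realType.
Local Notation E4 := 'rV[R]_4.
Local Notation net := (int -> int -> E4).
Implicit Types F N S : net.

(* Principal curvature of an edge: [g = - edge_curv f g *: f]. *)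
Definition edge_curv (f g : E4) : R := - dot g f / dot f f.

Definition curv1 F N m n := edge_curv (dm F m n) (dm N m n).
Definition curv2 F N m n := edge_curv (dn F m n) (dn N m n).

(* Common shape of nets in R^3 and S^3: in S^3 one takes [S = F], [eps = 1], in
   R^3 the constant quaternion [S = 1] and [eps = 0]. *)
Record framed_net (eps : R) F N S : Prop := FramedNet {
  framed_unit : forall m n,
    [/\ dot (S m n) (S m n) = 1, dot (N m n) (N m n) = 1 &
        dot (S m n) (N m n) = 0];
  framed_dm : forall m n,
    [/\ dm F m n <> 0, dm S m n = eps *: dm F m n,
        dm N m n = - curv1 F N m n *: dm F m n,
        2 * dot (S m n) (dm F m n) = - eps * dot (dm F m n) (dm F m n) &
        2 * dot (N m n) (dm F m n) = curv1 F N m n * dot (dm F m n) (dm F m n)];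
  framed_dn : forall m n,
    [/\ dn F m n <> 0, dn S m n = eps *: dn F m n,
        dn N m n = - curv2 F N m n *: dn F m n,
        2 * dot (S m n) (dn F m n) = - eps * dot (dn F m n) (dn F m n) &
        2 * dot (N m n) (dn F m n) = curv2 F N m n * dot (dn F m n) (dn F m n)] }.

Definition label1 H F N m n :=
  (H - curv1 F N m n) * dot (dm F m n) (dm F m n).
Definition label2 H F N m n :=
  (H - curv2 F N m n) * dot (dn F m n) (dn F m n).

Definition dir1 F m n := qdir (dm F m n).
Definition dir2 F m n := qdir (dn F m n).

Record isothermic_net (H : R) F N : Prop := IsothermicNet {
  iso_label1 : forall m n, label1 H F N m (n + 1) = label1 H F N m n;
  iso_label2 : forall m n, label2 H F N (m + 1) n = label2 H F N m n;
  iso_prod : forall m n,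
    (H - curv1 F N m n) * (H - curv1 F N m (n + 1)) =
    (H - curv2 F N m n) * (H - curv2 F N (m + 1) n);
  iso_cross : forall m n,
    qmul (dir1 F m n) (qconj (dir2 F (m + 1) n)) =
    - qmul (dir2 F m n) (qconj (dir1 F m (n + 1)));
  iso_cross_conj : forall m n,
    qmul (qconj (dir1 F m n)) (dir2 F (m + 1) n) =
    - qmul (qconj (dir2 F m n)) (dir1 F m (n + 1)) }.

Definition signed_net H F N := forall m n,
  H < curv1 F N m n /\ curv2 F N m n < H.

Definition transpose (f : net) : net := fun m n => f n m.

Lemma framed_transpose eps F N S :
  framed_net eps F N S ->
  framed_net eps (transpose F) (transpose N) (transpose S).
Proof.
case=> hu h1 h2; split=> m n; [exact: hu|exact: h2|exact: h1].
Qed.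

Lemma isothermic_transpose H F N :
  isothermic_net H F N -> isothermic_net H (transpose F) (transpose N).
Proof.
case=> l1 l2 pr c c'; split=> m n.
- exact: l2.
- exact: l1.
- by have := pr n m; rewrite /curv1 /curv2 /dm /dn /transpose => /esym.
- by have := c n m; rewrite /dir1 /dir2 /dm /dn /transpose => ->; rewrite opprK.
- by have := c' n m; rewrite /dir1 /dir2 /dm /dn /transpose => ->; rewrite opprK.
Qed.

(** With g = c f, the equal lengths of N and N + g give c (2 dot N f + c dot f f) = 0; the last
    hypothesis covers c = 0. *)
Lemma edge_curvP (f g N : E4) : f <> 0 -> parallel f g ->
  dot N N = 1 -> dot (N + g) (N + g) = 1 -> (g = 0 -> dot f N = 0) ->
  g = - edge_curv f g *: f /\ 2 * dot N f = edge_curv f g * dot f f.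
Proof.
move=> f0 [a [b [ab e]]] N1 N2 g0.
have ff : dot f f != 0 by apply/eqP => /dot_eq0.
have b0 : b != 0.
  apply/eqP => b0; move: ab e; rewrite b0 eqxx orbF scale0r => a0 /(congr1 (fun x => a^-1 *: x)).
  by rewrite scalerA mulVf // scale1r scaler0.
have gE : g = (a / b) *: f.
  by rewrite mulrC -scalerA e scalerA mulVf ?scale1r.
have kE : edge_curv f g = - (a / b).
  by rewrite /edge_curv {1}gE dotZl mulNr mulfK.
rewrite kE opprK; split=> //.
have [c0|c0] := eqVneq (a / b) 0.
  by rewrite c0 dotC g0 ?mulr0 ?oppr0 ?mul0r // gE c0 scale0r.
move: N2; rewrite gE !dot_lin N1 (dotC f N) => N2.
by apply: (mulfI c0); lra.
Qed.

Lemma quad_edges (A B C D : E4) (s t : R) :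
  (1 - s) *: A + s *: C = (1 - t) *: B + t *: D ->
  let d1 := C - A in let d2 := D - B in
  [/\ B - A = edge01 s t d1 d2, C - B = edge1_12 s t d1 d2,
      D - A = edge02 s t d1 d2 & C - D = edge2_12 s t d1 d2].
Proof.
move=> e d1 d2.
have eB : B - A = edge01 s t d1 d2.
  rewrite /edge01 /d1 /d2; apply/eqP; rewrite -subr_eq0; move/eqP: e.
  rewrite -subr_eq0 => /eqP e; apply/eqP; rewrite -[RHS]oppr0 -e; qring.
have BE : B = A + edge01 s t d1 d2 by rewrite -eB; qring.
split=> //.
- by rewrite {1}BE /edge01 /edge1_12 {1}/d1; qring.
- rewrite (_ : D = B + d2); last by rewrite /d2; qring.
  by rewrite {1}BE /edge01 /edge02 ; qring.
- rewrite {1}(_ : D = B + d2); last by rewrite /d2; qring.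
  by rewrite {1}BE /edge01 /edge2_12 {1}/d1; qring.
Qed.

(** * Signs of the dual factors and the isothermic property *)

Section CMC.
Variables (eps H : R) (F N S : net).
Hypotheses (framed : framed_net eps F N S) (cmc : const_mean_curvature F N H).
Hypotheses (emb : embedded_faces F) (nonumb : non_umbilic F N H).

Let r1 m n := H - curv1 F N m n.
Let r2 m n := H - curv2 F N m n.

Lemma cmc_ratios m n : exists s t, [/\ 0 < s < 1, 0 < t < 1,
  dual_ratios s t (r1 m n) (r2 (m + 1) n) (r2 m n) (r1 m (n + 1)) &
  (1 - s) *: F m n + s *: F (m + 1) (n + 1)
      = (1 - t) *: F (m + 1) n + t *: F m (n + 1)].
Proof.
have [_ [s [t [s01 t01 e]]]] := emb m n; exists s, t; split=> //.
have [_ _ h1 _ _] := framed_dm framed m n.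
have [_ _ h4 _ _] := framed_dm framed m (n + 1).
have [_ _ h3 _ _] := framed_dn framed m n.
have [_ _ h2 _ _] := framed_dn framed (m + 1) n.
exact: (face_dual_ratios (cmc m n) s01 t01 e).
Qed.

(** As s, t, 1 - s, 1 - t are positive, the dual ratios keep the sign between opposite edges and
    reverse it between adjacent ones. *)
Lemma cmc_sg m n : [/\ Num.sg (r1 m (n + 1)) = Num.sg (r1 m n),
  Num.sg (r2 m n) = - Num.sg (r1 m n) &
  Num.sg (r2 (m + 1) n) = - Num.sg (r1 m n)].
Proof.
have [s [t [s01 t01 [e3 e2 e4] _]]] := cmc_ratios m n.
have pos (x : R) : 0 < x -> Num.sg x = 1 by exact: gtr0_sg.
split.
- move/(congr1 Num.sg): e4; rewrite !sgrM !(pos s) ?(pos t) ?(pos (1 - s));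
  rewrite ?(pos (1 - t)) ?mulr1 //; lra.
- move/(congr1 Num.sg): e3; rewrite sgrN !sgrM (pos t) ?(pos (1 - t));
  rewrite ?mulr1 //; lra.
- move/(congr1 Num.sg): e2; rewrite sgrN !sgrM (pos s) ?(pos (1 - s));
  rewrite ?mulr1 //; lra.
Qed.

Lemma cmc_sg_const m n : Num.sg (r1 m n) = Num.sg (r1 0 0) /\
                         Num.sg (r2 m n) = - Num.sg (r1 0 0).
Proof.
have h : Num.sg (r1 m n) = Num.sg (r1 0 0).
  move: m n; apply: int2_shift_ind => // m n.
    have [_ _ e] := cmc_sg m n; have [_ e' _] := cmc_sg (m + 1) n.
    by move: e; rewrite e' => /oppr_inj ->.
  by have [-> _ _] := cmc_sg m n.
by split=> //; have [_ -> _] := cmc_sg m n; rewrite h.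
Qed.

(** If one factor vanished, all would; being the factors from the edges of F to those of N + H F,
    they would make the latter net constant. *)
Lemma cmc_r_neq0 : r1 0 0 != 0.
Proof.
apply/negP => /eqP z; apply: nonumb.
have z12 m n : r1 m n = 0 /\ r2 m n = 0.
  have [] := cmc_sg_const m n; rewrite z sgr0 oppr0 => /eqP + /eqP.
  by rewrite !sgr_eq0 => /eqP-> /eqP->.
apply: int2_shift_ind => // m n.
  suff -> : cm_dual F N H (m + 1) n = cm_dual F N H m n by [].
  have [_ _ h _ _] := framed_dm framed m n; have [z1 _] := z12 m n.
  apply/eqP; rewrite -subr_eq0; apply/eqP; rewrite /cm_dual.
  transitivity (dm N m n + H *: dm F m n); first by rewrite /dm; qring.
  by rewrite h -scalerDl addrC -/(r1 m n) z1 scale0r.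
suff -> : cm_dual F N H m (n + 1) = cm_dual F N H m n by [].
have [_ _ h _ _] := framed_dn framed m n; have [_ z1] := z12 m n.
apply/eqP; rewrite -subr_eq0; apply/eqP; rewrite /cm_dual.
transitivity (dn N m n + H *: dn F m n); first by rewrite /dn; qring.
by rewrite h -scalerDl addrC -/(r2 m n) z1 scale0r.
Qed.

Lemma cmc_isothermic : isothermic_net H F N.
Proof.
have r10 m n : r1 m n != 0.
  have [h _] := cmc_sg_const m n; have := cmc_r_neq0.
  by rewrite -!(sgr_eq0 (r1 _ _)) h.
suff main m n : [/\ label1 H F N m (n + 1) = label1 H F N m n,
  label2 H F N (m + 1) n = label2 H F N m n,
  (H - curv1 F N m n) * (H - curv1 F N m (n + 1)) =
    (H - curv2 F N m n) * (H - curv2 F N (m + 1) n),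
  qmul (dir1 F m n) (qconj (dir2 F (m + 1) n)) =
    - qmul (dir2 F m n) (qconj (dir1 F m (n + 1))) &
  qmul (qconj (dir1 F m n)) (dir2 F (m + 1) n) =
    - qmul (qconj (dir2 F m n)) (dir1 F m (n + 1))].
  by split=> m n; case: (main m n).
have [s [t [s01 t01 rr qe]]] := cmc_ratios m n.
have [f10 _ hN1 _ g1] := framed_dm framed m n.
have [f40 _ _ _ g4] := framed_dm framed m (n + 1).
have [f30 _ hN3 _ g3] := framed_dn framed m n.
have [f20 _ _ _ g2] := framed_dn framed (m + 1) n.
have [] := quad_edges qe.
set d1 := F (m + 1) (n + 1) - F m n; set d2 := F m (n + 1) - F (m + 1) n.
rewrite -/(dm F m n) -/(dn F (m + 1) n) -/(dn F m n) -/(dm F m (n + 1)).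
move=> E1 E2 E3 E4.
have circ : s * (1 - s) * dot d1 d1 = t * (1 - t) * dot d2 d2.
  apply: (face_circular (H := H) (N0 := N m n) s01 t01 (r10 m n) rr).
  - by rewrite -E1 g1 /r1; congr (_ * _); ring.
  (* The second edge starts at the neighbour, whose normal is [N m n] minus the curvature times the
     first edge. *)
  - rewrite -E1 -E2 /r2 (_ : H - (H - _) = curv2 F N (m + 1) n); last by ring.
    rewrite -g2; congr (_ * dot _ _).
    rewrite (_ : N (m + 1) n = N m n + dm N m n); last by rewrite /dm; qring.
    by rewrite hN1 -scaleNr /r1; congr (_ + _ *: _); ring.
  - by rewrite -E3 g3 /r2; congr (_ * _); ring.
  - rewrite -E3 -E4 /r1 (_ : H - (H - _) = curv1 F N m (n + 1)); last by ring.
    rewrite -g4; congr (_ * dot _ _).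
    rewrite (_ : N m (n + 1) = N m n + dn N m n); last by rewrite /dn; qring.
    by rewrite hN3 -scaleNr /r2; congr (_ + _ *: _); ring.
have [l1 l3 pr] := face_labels s01 t01 circ rr.
have [c c'] := face_cross_ratio circ.
move: l1 l3 c c'; rewrite -E1 -E2 -E3 -E4 => l1 l3 c c'; split.
- by rewrite /label1 -/(r1 m (n + 1)) -/(r1 m n) l1.
- by rewrite /label2 -/(r2 (m + 1) n) -/(r2 m n) l3.
- by rewrite -/(r1 m n) -/(r1 m (n + 1)) -/(r2 m n) -/(r2 (m + 1) n) pr mulrC.
- have := dir_opp t01 (qmul_neq0 f30 (qconj_neq0 f40)) c.
  by rewrite !qdirM !qdirC.
- have := dir_opp t01 (qmul_neq0 (qconj_neq0 f30) f40) c'.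
  by rewrite !qdirM !qdirC.
Qed.

Lemma cmc_signed : signed_net H F N \/
  signed_net H (transpose F) (transpose N).
Proof.
have := cmc_r_neq0; rewrite neq_lt => /orP[] r0; [left|right] => m n.
  have [] := cmc_sg_const m n; rewrite (ltr0_sg r0) opprK => /eqP + /eqP.
  by rewrite sgr_cp0 sgr_cp0 /r1 /r2; lra.
have [+ _] := cmc_sg_const n m; have [_] := cmc_sg_const n m.
rewrite (gtr0_sg r0) => /eqP + /eqP; rewrite !sgr_cp0.
by rewrite /signed_net /curv1 /curv2 /dm /dn /transpose /r1 /r2 /curv1 /curv2 /dm /dn; lra.
Qed.

End CMC.
End Isothermic.

(** * Spin frames of a net *)

Section SpinFrame.
Variable R : realType.
Local Notation E4 := 'rV[R]_4.
Implicit Types c e p q x : E4.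

Definition Qi : E4 := mkq 0 1 0 0.
Definition Qj : E4 := mkq 0 0 1 0.
Definition Qk : E4 := mkq 0 0 0 1.

(* Transport of the pair (Phi(lambda_1), Phi(lambda_2)) along an edge of
   direction [e]; [c] is i for the first direction and -j for the second. *)
Definition spin_step c e (pq : E4 * E4) : E4 * E4 :=
  (- qmul c (qmul pq.2 (qconj e)), qmul c (qmul pq.1 e)).

Definition imag_unit c := qmul c c = - q1 R.

Lemma imag_unit_Qi : imag_unit Qi.
Proof. rewrite /imag_unit /Qi /q1; qring. Qed.

Lemma imag_unit_NQj : imag_unit (- Qj).
Proof. rewrite /imag_unit /Qj /q1; qring. Qed.

Lemma spin_stepK c e : imag_unit c -> dot e e = 1 ->
  cancel (spin_step c e) (spin_step c e).
Proof.
move=> cc ee [p q]; rewrite /spin_step /=; congr pair.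
  by rewrite -!qmulA qmul_conj ee scale1r qmulq1 (qmulA c) cc qmulNl qmul1 opprK.
rewrite qmulNl -!qmulA qconj_mul ee scale1r qmulq1 qmulNr (qmulA c) cc.
by rewrite qmulNl qmul1 opprK.
Qed.

Lemma spin_step_comm c c' e1 e2 e3 e4 pq : qmul c' c = - qmul c c' ->
  qmul e1 (qconj e2) = - qmul e3 (qconj e4) ->
  qmul (qconj e1) e2 = - qmul (qconj e3) e4 ->
  spin_step c' e2 (spin_step c e1 pq) = spin_step c e4 (spin_step c' e3 pq).
Proof.
case: pq => p q cc h h'; rewrite /spin_step /=; congr pair.
  by rewrite -!qmulA h !qmulNr opprK (qmulA c' c) cc qmulNl -qmulA.
by rewrite !qmulNl -!qmulA h' !qmulNr opprK (qmulA c' c) cc qmulNl -qmulA.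
Qed.

Variables (cg sg : R).

(** With M = cg + sg k these are p s conj(q) = M and p n conj(q) = - k M, the immersion formula at
    one vertex. *)
Definition spin_frame (s n : E4) (pq : E4 * E4) :=
  [/\ dot pq.1 pq.1 = 1, dot pq.2 pq.2 = 1,
      qmul pq.1 (qmul s (qconj pq.2)) = mkq cg 0 0 sg &
      qmul pq.1 (qmul n (qconj pq.2)) = - mkq (- sg) 0 0 cg].

(** For a unit e, the reflection in the hyperplane orthogonal to e; it carries both S and N across
    an edge of direction e. *)
Definition qrefl e x : E4 := - qmul e (qmul (qconj x) e).

Lemma qreflE e x : dot e e = 1 -> qrefl e x = x - (2 * dot x e) *: e.
Proof.
move=> ee; transitivity (dot e e *: x - (2 * dot x e) *: e).
  by rewrite /qrefl; qring.
by rewrite ee scale1r.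
Qed.

Lemma qreflK e : dot e e = 1 -> involutive (qrefl e).
Proof.
move=> ee x; rewrite !qreflE // !dot_lin ee; apply: q_ext; rewrite ?qE; ring.
Qed.

Definition off_unit c := imag_unit c /\ exists a b, c = mkq 0 a b 0.

Lemma off_unit_Qi : off_unit Qi.
Proof. by split; [exact: imag_unit_Qi|exists 1, 0]. Qed.

Lemma off_unit_NQj : off_unit (- Qj).
Proof.
by split; [exact: imag_unit_NQj|exists 0, (-1); rewrite /Qj; qring].
Qed.

Lemma off_unit_sqr a b : imag_unit (mkq 0 a b 0) -> a ^+ 2 + b ^+ 2 = 1.
Proof.
by move/(congr1 (fun x => - qw x)); rewrite /q1; qexp => h; rewrite -[RHS]opprK -h; ring.
Qed.

Lemma off_unit_dot c : off_unit c -> dot c c = 1.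
Proof.
by case=> cc [a [b cE]]; move: cc; rewrite cE => /off_unit_sqr <-; qexp; ring.
Qed.

(** The new product is c conj(p x conj(q)) conj(c). On the span of 1 and k, conjugation by a unit c
    from the span of i and j is quaternionic conjugation, so M and k M are preserved. *)
Lemma spin_step_frame c e s n pq : off_unit c -> dot e e = 1 ->
  spin_frame s n pq -> spin_frame (qrefl e s) (qrefl e n) (spin_step c e pq).
Proof.
move=> oc ee; have c1 := off_unit_dot oc.
case: oc => _ [a [b cE]].
have ab : a ^+ 2 + b ^+ 2 = 1 by rewrite -c1 cE; qexp; ring.
case: pq => p q [/= pp qq hs hn]; rewrite /spin_step.
have key x : qmul (- qmul c (qmul q (qconj e)))
    (qmul (qrefl e x) (qconj (qmul c (qmul p e)))) =
    qmul c (qmul (qconj (qmul p (qmul x (qconj q)))) (qconj c)).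
  rewrite /qrefl !qconjM qconjK !qmulNl !qmulNr opprK -!qmulA.
  by rewrite (qmulA e (qconj e)) qmul_conj ee scale1r qmul1 (qmulA (qconj e) e)
    qconj_mul ee scale1r qmul1.
split=> /=.
- by rewrite dotNl dotNr opprK !dot_qmul dot_conj c1 qq ee !mulr1.
- by rewrite !dot_qmul c1 pp ee !mulr1.
- rewrite key hs cE; apply: q_ext; qexp; rewrite -[RHS]mulr1 -ab; ring.
- rewrite key hn cE; apply: q_ext; qexp; rewrite -[RHS]mulr1 -ab; ring.
Qed.

Lemma spin_step_frameE c e s n pq : off_unit c -> dot e e = 1 ->
  spin_frame s n pq <-> spin_frame (qrefl e s) (qrefl e n) (spin_step c e pq).
Proof.
move=> oc ee; split; first exact: spin_step_frame.
move/(spin_step_frame oc ee); rewrite !qreflK // spin_stepK //.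
by case: oc.
Qed.

Lemma dot_frame p q x y : dot p p = 1 -> dot q q = 1 ->
  dot (qmul p (qmul x (qconj q))) (qmul p (qmul y (qconj q))) = dot x y.
Proof.
move=> pp qq; transitivity (dot p p * dot q q * dot x y); last first.
  by rewrite pp qq !mul1r.
qexp; ring.
Qed.

Section Edge.
(* [tau] is [1/u] for the first direction and [-1/v] for the second. *)
Variables (eps H s l kappa u tau al : R) (S N e p q : E4).
Hypotheses (cs2 : cg ^+ 2 + sg ^+ 2 = 1) (cs_cos : cg ^+ 2 - sg ^+ 2 = H * s).
Hypothesis cs_sin : 2 * (cg * sg) = eps * s.
Hypotheses (fr : spin_frame S N (p, q)).
Hypotheses (Se : 2 * dot S e = - (eps * l)) (Ne : 2 * dot N e = kappa * l).
Hypotheses (all : al * l = 2 * (s * u)) (ktau : kappa * s * u = H * s * u + tau).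

Let x := qmul p (qmul e (qconj q)).

(** The products of e with S and N are the components of x along the orthonormal pair M, - k M.
    Solving for the real and k components leaves the double angle relations [cs_cos] and [cs_sin] to
    be inserted. *)
Lemma frame_edge : al * qw x = - (sg * (u - tau)) /\
                   al * qz x = - (cg * (u + tau)).
Proof.
case: fr => /= pp qq hs hn.
have h1 : 2 * (cg * qw x + sg * qz x) = - (eps * l).
  rewrite -Se -(dot_frame S e pp qq) hs -/x; qexp; ring.
have h2 : 2 * (sg * qw x - cg * qz x) = kappa * l.
  rewrite -Ne -(dot_frame N e pp qq) hn -/x; qexp; ring.
have xw : 2 * qw x = cg * - (eps * l) + sg * (kappa * l).
  by rewrite -h1 -h2 -[LHS]mulr1 -cs2; ring.
have xz : 2 * qz x = sg * - (eps * l) - cg * (kappa * l).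
  by rewrite -h1 -h2 -[LHS]mulr1 -cs2; ring.
have two : (2 : R) != 0 by rewrite pnatr_eq0.
split; apply: (mulfI two).
- transitivity (al * (2 * qw x)); first by ring.
  rewrite xw; transitivity (al * l * (sg * kappa - cg * eps)); first by ring.
  rewrite all; transitivity (2 * (sg * (kappa * s * u)) - 2 * u * cg * (eps * s)).
    by ring.
  rewrite ktau -cs_sin -cs_cos.
  transitivity (2 * sg * (tau - u * (cg ^+ 2 + sg ^+ 2))); first by ring.
  by rewrite cs2; ring.
- transitivity (al * (2 * qz x)); first by ring.
  rewrite xz; transitivity (- (al * l * (cg * kappa + sg * eps))); first by ring.
  rewrite all; transitivity (- (2 * (cg * (kappa * s * u)) + 2 * u * sg * (eps * s))).
    by ring.
  rewrite ktau -cs_sin -cs_cos.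
  transitivity (- (2 * cg * (tau + u * (cg ^+ 2 + sg ^+ 2)))); first by ring.
  by rewrite cs2; ring.
Qed.

End Edge.
End SpinFrame.

(** * Compatibility of the Lax matrices *)

Section LaxQuaternions.
Variable R : realType.
Local Notation E4 := 'rV[R]_4.

(* The numerators of U and V at lambda = c + i s, as quaternions; here
   [ui = 1/u], [vi = 1/v], a = a0 - i a3 and b = b0 - i b3. *)
Definition Uhat (a0 a3 u ui c s : R) : E4 := mkq a0 (s * (u - ui)) (c * (u + ui)) a3.
Definition Vhat (b0 b3 v vi c s : R) : E4 := mkq b0 (c * (v - vi)) (- (s * (v + vi))) b3.

(* The entries of the compatibility condition are Laurent polynomials in lambda
   with two coefficients off the diagonal, and a single one on it once
   u u' = v v'. So one value of lambda and the closing condition suffice. *)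
Lemma Uhat_Vhat_comm (a0 a3 u ui a0' a3' u' ui' b0 b3 v vi b0' b3' v' vi' c s x y : R) :
  c ^+ 2 + s ^+ 2 = 1 -> x ^+ 2 + y ^+ 2 = 1 ->
  v' * ui = u' * vi -> u * vi' = v * ui' ->
  qmul (Vhat b0' b3' v' vi' c s) (Uhat a0 a3 u ui c s) =
  qmul (Uhat a0' a3' u' ui' c s) (Vhat b0 b3 v vi c s) ->
  v' *: qmul (- Qj R) (Uhat a0 a3 u ui c (- s))
    + u *: qmul (Vhat b0' b3' v' vi' c s) (Qi R) =
  u' *: qmul (Qi R) (Vhat b0 b3 v vi c (- s))
    + v *: qmul (Uhat a0' a3' u' ui' c s) (- Qj R) ->
  qmul (Vhat b0' b3' v' vi' x y) (Uhat a0 a3 u ui x y) =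
  qmul (Uhat a0' a3' u' ui' x y) (Vhat b0 b3 v vi x y).
Proof.
move=> cs xy w1 w2 h e.
(* [eP] and [eQ] equate the off-diagonal coefficients of lambda. *)
have eP : v' * a0 - u * b3' = v * a0' + u' * b3.
  move/(congr1 (@qy R)): e; rewrite /Uhat /Vhat /Qi /Qj; qexp; lra.
have eQ : v' * a3 - u * b0' = - (u' * b0) - v * a3'.
  move/(congr1 (@qx R)): e; rewrite /Uhat /Vhat /Qi /Qj; qexp; lra.
(* [P] and [Q] are the defects of the coefficients of 1 / lambda; the known value of lambda gives
   them up to a rotation. *)
set P := vi' * a0 + ui * b3' - (vi * a0' - ui' * b3).
set Q := vi' * a3 + ui * b0' - (ui' * b0 - vi * a3').
have hx : c * P + s * Q = 0.
  have ec := congr1 (fun z => c * z) eP; have es := congr1 (fun z => s * z) eQ.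
  move/(congr1 (@qx R)): h; rewrite /P /Q /Uhat /Vhat; qexp; lra.
have hy : c * Q - s * P = 0.
  have ec := congr1 (fun z => c * z) eQ; have es := congr1 (fun z => s * z) eP.
  move/(congr1 (@qy R)): h; rewrite /P /Q /Uhat /Vhat; qexp; lra.
have P0 : P = 0.
  transitivity (c * (c * P + s * Q) - s * (c * Q - s * P)); last first.
    by rewrite hx hy; ring.
  by rewrite -[LHS]mul1r -cs; ring.
have Q0 : Q = 0.
  transitivity (s * (c * P + s * Q) + c * (c * Q - s * P)); last first.
    by rewrite hx hy; ring.
  by rewrite -[LHS]mul1r -cs; ring.
have w1m z : z * v' * ui = z * u' * vi by rewrite -!mulrA w1.
have w2m z : z * u * vi' = z * v * ui' by rewrite -!mulrA w2.
have xyE : x ^+ 2 = c ^+ 2 + s ^+ 2 - y ^+ 2 by rewrite cs -xy; ring.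
apply: q_ext.
- move/(congr1 (@qw R)): h; rewrite /Uhat /Vhat; qexp.
  have := w1m (c * s); have := w2m (c * s).
  have := w1m (x * y); have := w2m (x * y); lra.
- have := congr1 (fun z => x * z) eP; have := congr1 (fun z => y * z) eQ.
  have := congr1 (fun z => x * z) P0; have := congr1 (fun z => y * z) Q0.
  rewrite /P /Q /Uhat /Vhat; qexp; lra.
- have := congr1 (fun z => x * z) eQ; have := congr1 (fun z => y * z) eP.
  have := congr1 (fun z => x * z) Q0; have := congr1 (fun z => y * z) P0.
  rewrite /P /Q /Uhat /Vhat; qexp; lra.
- move/(congr1 (@qz R)): h; rewrite /Uhat /Vhat; qexp.
  have := w1m (c ^+ 2); have := w2m (c ^+ 2).
  have := w1m (s ^+ 2); have := w2m (s ^+ 2).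
  have := w1m (x ^+ 2); have := w2m (x ^+ 2).
  have := w1m (y ^+ 2); have := w2m (y ^+ 2).
  have mm z : x ^+ 2 * z = (c ^+ 2 + s ^+ 2 - y ^+ 2) * z by rewrite xyE.
  have := mm (u * v'); have := mm (u' * v); have := mm (ui * vi'); have := mm (ui' * vi).
  have := mm (u * vi'); have := mm (u' * vi); have := mm (ui * v'); have := mm (ui' * v).
  lra.
Qed.

End LaxQuaternions.

(** * Differentiable loops of unit quaternions *)

Section Derivatives.
Variable R : realType.
Local Notation E4 := 'rV[R]_4.
Implicit Types (f g : R -> R) (F G : R -> E4) (t : R).

Lemma isd_eq t f a b : is_derive t 1 f a -> a = b -> is_derive t 1 f b.
Proof. by move=> + <-. Qed.

Lemma isdM t f g a b : is_derive t 1 f a -> is_derive t 1 g b ->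
  is_derive t 1 (fun x => f x * g x) (a * g t + f t * b).
Proof.
move=> hf hg; have h := is_deriveM hf hg; apply: (isd_eq h).
by rewrite /GRing.scale /=; ring.
Qed.

Lemma isdD t f g a b : is_derive t 1 f a -> is_derive t 1 g b ->
  is_derive t 1 (fun x => f x + g x) (a + b).
Proof. by move=> hf hg; exact: is_deriveD. Qed.

Lemma isdN t f a : is_derive t 1 f a -> is_derive t 1 (fun x => - f x) (- a).
Proof. by move=> hf; exact: is_deriveN. Qed.

Lemma isdB t f g a b : is_derive t 1 f a -> is_derive t 1 g b ->
  is_derive t 1 (fun x => f x - g x) (a - b).
Proof. by move=> hf hg; exact: is_deriveB. Qed.

Lemma isdK t (c : R) : is_derive t 1 (fun=> c) 0.
Proof. exact: is_derive_cst. Qed.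

Lemma isd_cos t f a : is_derive t 1 f a ->
  is_derive t 1 (fun x => cos (f x)) (- sin (f t) * a).
Proof. by move=> hf; apply: is_derive1_comp. Qed.

Lemma isd_sin t f a : is_derive t 1 f a ->
  is_derive t 1 (fun x => sin (f x)) (cos (f t) * a).
Proof. by move=> hf; apply: is_derive1_comp. Qed.

Lemma isd_cos2 (t : R) : is_derive t 1 (fun x => cos x ^+ 2 - sin x ^+ 2)
  (- (4 * (cos t * sin t)) : R).
Proof.
have h := isdB (isdM (is_derive_cos t) (is_derive_cos t))
  (isdM (is_derive_sin t) (is_derive_sin t)).
have -> : (fun x : R => cos x ^+ 2 - sin x ^+ 2) =
   (fun x => cos x * cos x - sin x * sin x) by apply/funext => x; rewrite !expr2.
by apply: (isd_eq h); ring.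
Qed.

Lemma isd_sqrtV (t : R) (f : R -> R) a : 0 < Num.sqrt (f t) -> is_derive t 1 f a ->
  is_derive t 1 (fun x => (Num.sqrt (f x))^-1)
    (- (Num.sqrt (f t)) ^- 2 * ((2 * Num.sqrt (f t))^-1 * a)).
Proof.
move=> f0 hf; apply: is_deriveV; first by rewrite gt_eqF.
by apply: is_derive1_comp hf; apply: is_derive1_sqrt; rewrite -sqrtr_gt0.
Qed.

Lemma cis_unit (t : R) : complex.Re (cis t) ^+ 2 + complex.Im (cis t) ^+ 2 = 1 :> R.
Proof. exact: cos2Dsin2. Qed.

Definition q_is_derive F t (d : E4) :=
  [/\ is_derive t 1 (fun x => qw (F x)) (qw d),
      is_derive t 1 (fun x => qx (F x)) (qx d),
      is_derive t 1 (fun x => qy (F x)) (qy d) &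
      is_derive t 1 (fun x => qz (F x)) (qz d)].

Lemma qd_mul F G t a b : q_is_derive F t a -> q_is_derive G t b ->
  q_is_derive (fun x => qmul (F x) (G x)) t (qmul a (G t) + qmul (F t) b).
Proof.
move=> [Fw Fx Fy Fz] [Gw Gx Gy Gz].
split; rewrite /qmul ?qE; under eq_fun do rewrite ?qE.
- by apply: (isd_eq (isdB (isdB (isdB (isdM Fw Gw) (isdM Fx Gx)) (isdM Fy Gy)) (isdM Fz Gz))); ring.
- by apply: (isd_eq (isdB (isdD (isdD (isdM Fw Gx) (isdM Fx Gw)) (isdM Fy Gz)) (isdM Fz Gy))); ring.
- by apply: (isd_eq (isdB (isdD (isdD (isdM Fw Gy) (isdM Fy Gw)) (isdM Fz Gx)) (isdM Fx Gz))); ring.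
- by apply: (isd_eq (isdB (isdD (isdD (isdM Fw Gz) (isdM Fz Gw)) (isdM Fx Gy)) (isdM Fy Gx))); ring.
Qed.

Lemma qd_conj F t a : q_is_derive F t a ->
  q_is_derive (fun x => qconj (F x)) t (qconj a).
Proof.
move=> [Fw Fx Fy Fz].
split; rewrite /qconj ?qE; under eq_fun do rewrite ?qE; try exact: isdN.
exact: Fw.
Qed.

Lemma qd_scale f F t a b : is_derive t 1 f a -> q_is_derive F t b ->
  q_is_derive (fun x => f x *: F x) t (a *: F t + f t *: b).
Proof.
move=> hf [Fw Fx Fy Fz].
by split; rewrite ?qE; under eq_fun do rewrite ?qE; exact: isdM.
Qed.

Lemma qd_unique F t a b : q_is_derive F t a -> q_is_derive F t b -> a = b.
Proof.
by move=> [aw ax ay az] [bw bx b_y bz]; apply: q_ext;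
  [case: aw bw|case: ax bx|case: ay b_y|case: az bz] => _ <- [_ <-].
Qed.

Lemma qd_mx F t d : q_is_derive F t d ->
  mx_derivable (fun x => quat (F x)) t /\
  mx_derive (fun x => quat (F x)) t = quat d.
Proof.
move=> [Fw Fx Fy Fz].
have E f a : is_derive t 1 f a -> derivable f t 1 /\ f^`()%classic t = a.
  by move=> h; split; [exact: ex_derive|rewrite derive1E derive_val].
have H i j : exists f1 f2 d1 d2,
   [/\ forall x, quat (F x) i j = (f1 x +i* f2 x)%C,
       quat d i j = (d1 +i* d2)%C, is_derive t 1 f1 d1 & is_derive t 1 f2 d2].
  have e y : quat y i j = if i == 0 then (if j == 0 then (qw y -i* qz y)%C
      else (- qy y -i* qx y)%C) else (if j == 0 then (qy y -i* qx y)%C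
      else (qw y +i* qz y)%C) by rewrite quatE mxE.
  case: (i == 0) (j == 0) e => [] [] e.
  - exists (fun x => qw (F x)), (fun x => - qz (F x)), (qw d), (- qz d).
    by split=> //; exact: isdN.
  - exists (fun x => - qy (F x)), (fun x => - qx (F x)), (- qy d), (- qx d).
    by split=> //; exact: isdN.
  - exists (fun x => qy (F x)), (fun x => - qx (F x)), (qy d), (- qx d).
    by split=> //; exact: isdN.
  - by exists (fun x => qw (F x)), (fun x => qz (F x)), (qw d), (qz d).
split=> [i j|].
  have [f1 [f2 [d1 [d2 [e _ /E[h1 _] /E[h2 _]]]]]] := H i j.
  by split; under eq_fun do rewrite e /=.
apply/matrixP=> i j; rewrite mxE.
have [f1 [f2 [d1 [d2 [e -> /E[_ h1] /E[_ h2]]]]]] := H i j.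
have -> : (fun x => complex.Re (quat (F x) i j)) = f1.
  by apply/funext => x; rewrite e.
have -> : (fun x => complex.Im (quat (F x) i j)) = f2.
  by apply/funext => x; rewrite e.
by rewrite h1 h2.
Qed.

(** Hopf coordinates exp (A k) (cos B + sin B exp (phi k) i) of S^3. The twist is B -> - B, so a
    loop is twisted as soon as A is even and B is odd in lambda. *)
Definition hopf (A B phi : R) : E4 :=
  mkq (cos A * cos B) (sin B * cos (phi + A)) (sin B * sin (phi + A))
      (sin A * cos B).

Lemma hopf_unit A B phi : dot (hopf A B phi) (hopf A B phi) = 1.
Proof.
transitivity (((cos A ^+ 2 + sin A ^+ 2) * cos B ^+ 2) +
  sin B ^+ 2 * (cos (phi + A) ^+ 2 + sin (phi + A) ^+ 2)).
  by rewrite /hopf; qexp; ring.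
by rewrite !cos2Dsin2 mul1r mulr1 cos2Dsin2.
Qed.

Lemma hopf_twist A B phi : hopf A (- B) phi = qtwist (hopf A B phi).
Proof. by rewrite /hopf /qtwist ?qE sinN cosN; qring. Qed.

Lemma hopf_derive (A B : R -> R) phi t a b :
  is_derive t 1 A a -> is_derive t 1 B b ->
  q_is_derive (fun x => hopf (A x) (B x) phi) t
    (mkq (- sin (A t) * cos (B t) * a - cos (A t) * sin (B t) * b)
         (cos (B t) * cos (phi + A t) * b - sin (B t) * sin (phi + A t) * a)
         (cos (B t) * sin (phi + A t) * b + sin (B t) * cos (phi + A t) * a)
         (cos (A t) * cos (B t) * a - sin (A t) * sin (B t) * b)).
Proof.
move=> hA hB; have hp := isdD (isdK t phi) hA.
split; rewrite /hopf ?qE; under eq_fun do rewrite ?qE.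
- by apply: (isd_eq (isdM (isd_cos hA) (isd_cos hB))); ring.
- by apply: (isd_eq (isdM (isd_sin hB) (isd_cos hp))); ring.
- by apply: (isd_eq (isdM (isd_sin hB) (isd_sin hp))); ring.
- by apply: (isd_eq (isdM (isd_sin hA) (isd_cos hB))); ring.
Qed.

Lemma circle_polar (x y : R) : x ^+ 2 + y ^+ 2 = 1 ->
  exists a, x = cos a /\ y = sin a.
Proof.
move=> xy; have x1 : -1 <= x <= 1.
  by have y2 := sqr_ge0 y; apply/andP; split; nra.
have [c s] : cos (acos x) = x /\ sin (acos x) = `|y|.
  split; first by rewrite acosK // in_itv.
  by rewrite sin_acos // -xy addrAC subrr add0r sqrtr_sqr.
have [y0|y0] := leP 0 y.
  by exists (acos x); rewrite c s ger0_norm.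
by exists (- acos x); rewrite cosN sinN c s ltr0_norm // opprK.
Qed.

Lemma plane_polar (x y : R) : exists r a, x = r * cos a /\ y = r * sin a.
Proof.
have [h|h] := eqVneq (x ^+ 2 + y ^+ 2) 0.
  exists 0, 0; move/eqP: h; rewrite paddr_eq0 ?sqr_ge0 // !sqrf_eq0.
  by move=> /andP[/eqP-> /eqP->]; rewrite !mul0r.
have h0 : 0 < x ^+ 2 + y ^+ 2 by rewrite lt_neqAle eq_sym h addr_ge0 ?sqr_ge0.
set r := Num.sqrt (x ^+ 2 + y ^+ 2); have r0 : r != 0 by rewrite gt_eqF ?sqrtr_gt0.
have [|a [ax ay]] := @circle_polar (x / r) (y / r).
  by rewrite !exprMn -mulrDl exprVn sqr_sqrtr ?(ltW h0) // divff.
by exists r, a; rewrite -ax -ay ![r * _]mulrC !divfK.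
Qed.

Lemma hopf_surj (g : E4) : dot g g = 1 -> exists A B phi, g = hopf A B phi.
Proof.
move=> g1.
have [r [A [ew ez]]] := plane_polar (qw g) (qz g).
have [r' [B [ex ey]]] := plane_polar (qx g) (qy g).
have [C [c s]] : exists C, r = cos C /\ r' = sin C.
  apply: circle_polar; rewrite -g1 dotE ex ey ez ew.
  by rewrite -[in LHS](mulr1 (r ^+ 2)) -[in LHS](mulr1 (r' ^+ 2)) -{1}(cos2Dsin2 A) -(cos2Dsin2 B); ring.
exists A, C, (B - A); rewrite /hopf subrK; apply: q_ext; rewrite ?qE.
- by rewrite ew c mulrC.
- by rewrite ex s.
- by rewrite ey s.
- by rewrite ez c mulrC.
Qed.

Local Notation re := complex.Re.
Local Notation im := complex.Im.

Definition hopf_loop (a0 a1 b0 b1 phi : R) (z : R[i]) : E4 :=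
  hopf (a0 + a1 * (re z * im z)) (b0 * re z + b1 * im z) phi.

Lemma hopf_loop_twist a0 a1 b0 b1 phi z :
  hopf_loop a0 a1 b0 b1 phi (- z) = qtwist (hopf_loop a0 a1 b0 b1 phi z).
Proof.
rewrite /hopf_loop -hopf_twist; case: z => x y /=.
by congr (hopf _ _ _); ring.
Qed.

Lemma hopf_loop_derive a0 a1 b0 b1 phi t :
  exists d, q_is_derive (fun x => hopf_loop a0 a1 b0 b1 phi (cis x)) t d.
Proof.
have hA : is_derive t 1 (fun x => a0 + a1 * (cos x * sin x))
    (0 + (0 * (cos t * sin t) + a1 * (- sin t * sin t + cos t * cos t))).
  exact: (isdD (isdK _ a0) (isdM (isdK _ a1)
    (isdM (is_derive_cos _) (is_derive_sin _)))).
have hB : is_derive t 1 (fun x => b0 * cos x + b1 * sin x)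
    (0 * cos t + b0 * - sin t + (0 * sin t + b1 * cos t)).
  exact: (isdD (isdM (isdK _ b0) (is_derive_cos _))
    (isdM (isdK _ b1) (is_derive_sin _))).
by eexists; exact: (hopf_derive phi hA hB).
Qed.

(** A product of two loops, with values p, 1 and 1, q at the two points. Both angles are
    interpolated, A by 1 and cos sin, B by cos and sin, which needs cos g and sin g non-zero. *)
Lemma loop_through (g : R) (p q : E4) : cos g != 0 -> sin g != 0 ->
  dot p p = 1 -> dot q q = 1 ->
  exists psi : R[i] -> E4,
    [/\ forall z, dot (psi z) (psi z) = 1,
        forall z, psi (- z) = qtwist (psi z),
        forall t, exists d, q_is_derive (fun x => psi (cis x)) t d,
        psi (cis g) = p & psi (cis (- g)) = q].
Proof.
move=> c0 s0 /hopf_surj[A [B [phi ->]]] /hopf_surj[A' [B' [phi' ->]]].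
exists (fun z => qmul
  (hopf_loop (A / 2) (A / (2 * (cos g * sin g))) (B / (2 * cos g)) (B / (2 * sin g)) phi z)
  (hopf_loop (A' / 2) (- (A' / (2 * (cos g * sin g)))) (B' / (2 * cos g)) (- (B' / (2 * sin g))) phi' z)).
have h1 ph : hopf 0 0 ph = q1 R.
  by rewrite /hopf /q1 cos0 sin0; qring.
split.
- by move=> z; rewrite dot_qmul !hopf_unit mulr1.
- by move=> z; rewrite !hopf_loop_twist qtwistM.
- move=> t.
  have [d hd] := hopf_loop_derive (A / 2) (A / (2 * (cos g * sin g)))
    (B / (2 * cos g)) (B / (2 * sin g)) phi t.
  have [d' hd'] := hopf_loop_derive (A' / 2) (- (A' / (2 * (cos g * sin g))))
    (B' / (2 * cos g)) (- (B' / (2 * sin g))) phi' t.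
  by eexists; exact: qd_mul hd hd'.
- rewrite -[RHS]qmulq1 -(h1 phi') /hopf_loop /=.
  by congr (qmul (hopf _ _ _) (hopf _ _ _)); field; rewrite ?c0 ?s0.
- rewrite -[RHS]qmul1 -(h1 phi) /hopf_loop /= cosN sinN.
  by congr (qmul (hopf _ _ _) (hopf _ _ _)); field; rewrite ?c0 ?s0.
Qed.

(** At gamma = 0 the first factor passes through 1 with velocity y, the second through p with
    velocity 0. *)
Lemma loop_tangent (p y : E4) : dot p p = 1 -> qw y = 0 ->
  exists psi : R[i] -> E4,
    [/\ forall z, dot (psi z) (psi z) = 1,
        forall z, psi (- z) = qtwist (psi z),
        forall t, exists d, q_is_derive (fun x => psi (cis x)) t d,
        psi (cis 0) = p &
        q_is_derive (fun x => psi (cis x)) 0 (qmul y p)].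
Proof.
move=> /hopf_surj[A [B [phi ->]]] y0.
have [r [al [ex ey]]] := plane_polar (qx y) (qy y).
exists (fun z => qmul (hopf_loop 0 (qz y) 0 r al z) (hopf_loop A 0 B 0 phi z)).
have h1 ph : hopf 0 0 ph = q1 R.
  by rewrite /hopf /q1 cos0 sin0; qring.
have v1 : hopf_loop 0 (qz y) 0 r al (cis 0) = q1 R.
  by rewrite /hopf_loop /= cos0 sin0 !(mulr0, mul0r, addr0) h1.
have v2 : hopf_loop A 0 B 0 phi (cis 0) = hopf A B phi.
  by rewrite /hopf_loop /= cos0 sin0 !(mulr0, mul0r, mulr1, addr0).
split.
- by move=> z; rewrite dot_qmul !hopf_unit mulr1.
- by move=> z; rewrite !hopf_loop_twist qtwistM.
- move=> t.
  have [d hd] := hopf_loop_derive 0 (qz y) 0 r al t.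
  have [d' hd'] := hopf_loop_derive A 0 B 0 phi t.
  by eexists; exact: qd_mul hd hd'.
- by rewrite v1 v2 qmul1.
- have hA a0 a1 : is_derive (0 : R) 1 (fun x => a0 + a1 * (cos x * sin x)) a1.
    apply: (isd_eq (isdD (isdK _ a0) (isdM (isdK _ a1)
      (isdM (is_derive_cos _) (is_derive_sin _))))).
    by rewrite cos0 sin0; ring.
  have hB b0 b1 : is_derive (0 : R) 1 (fun x => b0 * cos x + b1 * sin x) b1.
    apply: (isd_eq (isdD (isdM (isdK _ b0) (is_derive_cos _))
      (isdM (isdK _ b1) (is_derive_sin _)))).
    by rewrite cos0 sin0; ring.
  have d1 := hopf_derive al (hA 0 (qz y)) (hB 0 r).
  have d2 := hopf_derive phi (hA A 0) (hB B 0).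
  have := qd_mul d1 d2.
  rewrite -/(cis 0) -[hopf (0 + _ * _) _ al]/(hopf_loop 0 (qz y) 0 r al (cis 0)).
  rewrite -[hopf (A + _) _ phi]/(hopf_loop A 0 B 0 phi (cis 0)) v1 v2.
  set D1 := mkq _ _ _ _; set D2 := mkq _ _ _ _.
  have -> : D1 = y.
    rewrite /D1 cos0 sin0 !(mulr0, mul0r, mulr1, addr0) cos0 sin0.
    by apply: q_ext; rewrite ?qE ?y0 ?ex ?ey; ring.
  have -> : D2 = 0.
    by rewrite /D2 !(mulr0, addr0, subr0, oppr0); qring.
  by rewrite qmul1 addr0.
Qed.

End Derivatives.

(** * The Lax pair of an isothermic net *)

Section LaxNet.
Variable R : realType.
Local Notation E4 := 'rV[R]_4.
Local Notation net := (int -> int -> E4).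
Variables (eps H s cg sg : R) (F N S : net) (p0 q0 : E4).
(** [eps_sg] covers both cases: eps = 1 in S^3, sg = 0 in R^3. *)
Hypotheses (eps_sg : eps * sg = sg) (s0 : 0 < s).
Hypotheses (cs2 : cg ^+ 2 + sg ^+ 2 = 1) (cs_cos : cg ^+ 2 - sg ^+ 2 = H * s).
Hypothesis cs_sin : 2 * (cg * sg) = eps * s.
Hypotheses (framed : framed_net eps F N S) (iso : isothermic_net H F N).
Hypothesis sgn : signed_net H F N.
Hypothesis off_dual : forall m n,
  dm F m n <> (H * s - 1) *: S m n + s *: N m n /\
  dn F m n <> - (H * s + 1) *: S m n - s *: N m n.
Hypothesis fr0 : spin_frame cg sg (S 0 0) (N 0 0) (p0, q0).

Let e1 m n := dir1 F m n.
Let e2 m n := dir2 F m n.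
Let stU m n := spin_step (Qi R) (e1 m n).
Let stV m n := spin_step (- Qj R) (e2 m n).

(** * The spin frame along the net *)

Lemma dir1_unit m n : dot (e1 m n) (e1 m n) = 1.
Proof. by have [h _ _ _ _] := framed_dm framed m n; exact: dot_qdir. Qed.

Lemma dir2_unit m n : dot (e2 m n) (e2 m n) = 1.
Proof. by have [h _ _ _ _] := framed_dn framed m n; exact: dot_qdir. Qed.

Definition spin_net : int -> int -> E4 * E4 := grid stU stU stV stV (p0, q0).
Let p m n := (spin_net m n).1.
Let q m n := (spin_net m n).2.

Lemma spin_net_m m n : spin_net (m + 1) n = stU m n (spin_net m n).
Proof.
apply: grid_m => {}m {}n.
- exact: spin_stepK (imag_unit_Qi R) (dir1_unit _ _).
- exact: spin_stepK (imag_unit_NQj R) (dir2_unit _ _).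
- exact: spin_stepK (imag_unit_NQj R) (dir2_unit _ _).
- move=> pq; apply: spin_step_comm; last 2 first.
  + exact: iso_cross iso m n.
  + exact: iso_cross_conj iso m n.
  by rewrite /Qi /Qj; qring.
Qed.

Lemma spin_net_n m n : spin_net m (n + 1) = stV m n (spin_net m n).
Proof.
apply: grid_n => {}m {}n.
exact: spin_stepK (imag_unit_NQj R) (dir2_unit _ _).
Qed.

Let l1 m n := qlen (dm F m n).
Let l2 m n := qlen (dn F m n).
Let k1 m n := curv1 F N m n.
Let k2 m n := curv2 F N m n.

Lemma edge1 m n : [/\ 0 < l1 m n, dm F m n = l1 m n *: e1 m n,
  2 * dot (S m n) (e1 m n) = - (eps * l1 m n) &
  2 * dot (N m n) (e1 m n) = k1 m n * l1 m n].
Proof.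
have [f0 _ _ hS hN] := framed_dm framed m n.
have l0 := qlen_gt0 f0; have fE := qlen_dir f0.
have l0' : qlen (dm F m n) != 0 by rewrite gt_eqF.
move: hS hN; rewrite -sqr_qlen => hS hN.
split=> //; apply: (mulfI l0').
- by rewrite mulrCA -dotZr /e1 /dir1 -fE hS /l1; ring.
- by rewrite mulrCA -dotZr /e1 /dir1 -fE hN /l1 /k1; ring.
Qed.

Lemma edge2 m n : [/\ 0 < l2 m n, dn F m n = l2 m n *: e2 m n,
  2 * dot (S m n) (e2 m n) = - (eps * l2 m n) &
  2 * dot (N m n) (e2 m n) = k2 m n * l2 m n].
Proof.
have [f0 _ _ hS hN] := framed_dn framed m n.
have l0 := qlen_gt0 f0; have fE := qlen_dir f0.
have l0' : qlen (dn F m n) != 0 by rewrite gt_eqF.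
move: hS hN; rewrite -sqr_qlen => hS hN.
split=> //; apply: (mulfI l0').
- by rewrite mulrCA -dotZr /e2 /dir2 -fE hS /l2; ring.
- by rewrite mulrCA -dotZr /e2 /dir2 -fE hN /l2 /k2; ring.
Qed.

Lemma refl_m m n : S (m + 1) n = qrefl (e1 m n) (S m n) /\
                   N (m + 1) n = qrefl (e1 m n) (N m n).
Proof.
have [_ fE hS hN] := edge1 m n; have [_ dS dN _ _] := framed_dm framed m n.
rewrite !qreflE ?dir1_unit // hS hN; split.
  rewrite (_ : S (m + 1) n = S m n + dm S m n); last by rewrite /dm; qring.
  by rewrite dS {1}fE scaleNr opprK scalerA.
rewrite (_ : N (m + 1) n = N m n + dm N m n); last by rewrite /dm; qring.
by rewrite dN {1}fE scaleNr scalerA.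
Qed.

Lemma refl_n m n : S m (n + 1) = qrefl (e2 m n) (S m n) /\
                   N m (n + 1) = qrefl (e2 m n) (N m n).
Proof.
have [_ fE hS hN] := edge2 m n; have [_ dS dN _ _] := framed_dn framed m n.
rewrite !qreflE ?dir2_unit // hS hN; split.
  rewrite (_ : S m (n + 1) = S m n + dn S m n); last by rewrite /dn; qring.
  by rewrite dS {1}fE scaleNr opprK scalerA.
rewrite (_ : N m (n + 1) = N m n + dn N m n); last by rewrite /dn; qring.
by rewrite dN {1}fE scaleNr scalerA.
Qed.

Lemma spin_netP m n : spin_frame cg sg (S m n) (N m n) (spin_net m n).
Proof.
move: m n; apply: int2_shift_ind => // m n.
  have [-> ->] := refl_m m n; rewrite spin_net_m.
  exact: spin_step_frameE (off_unit_Qi R) (dir1_unit m n).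
have [-> ->] := refl_n m n; rewrite spin_net_n.
exact: spin_step_frameE (off_unit_NQj R) (dir2_unit m n).
Qed.

Lemma spin_unit m n : dot (p m n) (p m n) = 1 /\ dot (q m n) (q m n) = 1.
Proof. by case: (spin_netP m n). Qed.

(** The values of alpha and beta at lambda_1. As functions of the labels they agree on opposite
    edges; the first label is negative because the curvature exceeds H there. The factor 4 s
    normalizes s (k1 - H) u^2 to 1. *)
Definition lax_al m n := Num.sqrt (4 * s / - label1 H F N m n).
Definition lax_be m n := Num.sqrt (4 * s / label2 H F N m n).
Definition lax_u m n := lax_al m n * l1 m n / (2 * s).
Definition lax_v m n := lax_be m n * l2 m n / (2 * s).

Lemma lax_uP m n : [/\ 0 < lax_al m n, 0 < lax_u m n,
  lax_al m n * l1 m n = 2 * (s * lax_u m n),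
  k1 m n * s * lax_u m n = H * s * lax_u m n + (lax_u m n)^-1 &
  s * (k1 m n - H) * lax_u m n ^+ 2 = 1].
Proof.
have [l0 _ _ _] := edge1 m n; have [k0 _] := sgn m n.
have lab : - label1 H F N m n = (k1 m n - H) * l1 m n ^+ 2.
  by rewrite /label1 -sqr_qlen /l1 /k1; ring.
have kp : 0 < k1 m n - H by rewrite subr_gt0.
have ap : 0 < 4 * s / - label1 H F N m n.
  by rewrite lab divr_gt0 ?mulr_gt0 ?exprn_gt0.
have a0 : 0 < lax_al m n by rewrite sqrtr_gt0.
have s20 : 2 * s != 0 by rewrite mulf_neq0 ?pnatr_eq0 ?gt_eqF.
have u0 : 0 < lax_u m n by rewrite divr_gt0 ?mulr_gt0.
have all : lax_al m n * l1 m n = 2 * (s * lax_u m n).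
  by rewrite /lax_u; field; rewrite gt_eqF.
have u2 : s * (k1 m n - H) * lax_u m n ^+ 2 = 1.
  rewrite /lax_u !exprMn exprVn sqr_sqrtr ?(ltW ap) // lab.
  by field; rewrite !gt_eqF.
split=> //; apply: (mulIf (x := lax_u m n)); first by rewrite gt_eqF.
rewrite mulrDl mulVf ?gt_eqF // -u2; ring.
Qed.

Lemma lax_vP m n : [/\ 0 < lax_be m n, 0 < lax_v m n,
  lax_be m n * l2 m n = 2 * (s * lax_v m n),
  k2 m n * s * lax_v m n = H * s * lax_v m n + - (lax_v m n)^-1 &
  s * (H - k2 m n) * lax_v m n ^+ 2 = 1].
Proof.
have [l0 _ _ _] := edge2 m n; have [_ k0] := sgn m n.
have lab : label2 H F N m n = (H - k2 m n) * l2 m n ^+ 2.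
  by rewrite /label2 -sqr_qlen /l2 /k2; ring.
have kp : 0 < H - k2 m n by rewrite subr_gt0.
have ap : 0 < 4 * s / label2 H F N m n.
  by rewrite lab divr_gt0 ?mulr_gt0 ?exprn_gt0.
have a0 : 0 < lax_be m n by rewrite sqrtr_gt0.
have s20 : 2 * s != 0 by rewrite mulf_neq0 ?pnatr_eq0 ?gt_eqF.
have u0 : 0 < lax_v m n by rewrite divr_gt0 ?mulr_gt0.
have all : lax_be m n * l2 m n = 2 * (s * lax_v m n).
  by rewrite /lax_v; field; rewrite gt_eqF.
have u2 : s * (H - k2 m n) * lax_v m n ^+ 2 = 1.
  rewrite /lax_v !exprMn exprVn sqr_sqrtr ?(ltW ap) // lab.
  by field; rewrite !gt_eqF.
split=> //; apply: (mulIf (x := lax_v m n)); first by rewrite gt_eqF.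
rewrite mulrDl mulNr mulVf ?gt_eqF // -u2; ring.
Qed.

Lemma lax_al_n m n : lax_al m (n + 1) = lax_al m n.
Proof. by rewrite /lax_al (iso_label1 iso). Qed.

Lemma lax_be_m m n : lax_be (m + 1) n = lax_be m n.
Proof. by rewrite /lax_be (iso_label2 iso). Qed.

(** The squares of u and v are inverse to s times the distance of the curvature from H, so
    [iso_prod] gives equality of the squares, and positivity the rest. *)
Lemma lax_uv m n : lax_u m n * lax_u m (n + 1) = lax_v m n * lax_v (m + 1) n.
Proof.
have [_ u0 _ _ e] := lax_uP m n; have [_ u0' _ _ e'] := lax_uP m (n + 1).
have [_ v0 _ _ h] := lax_vP m n; have [_ v0' _ _ h'] := lax_vP (m + 1) n.
have [k10 k20] := sgn m n; have [k10' _] := sgn m (n + 1).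
have pr := iso_prod iso m n; rewrite -/(k1 m n) -/(k2 m n) in pr k10 k20.
rewrite -/(k1 m (n + 1)) -/(k2 (m + 1) n) in pr k10'.
suff /eqP : (lax_u m n * lax_u m (n + 1)) ^+ 2 =
    (lax_v m n * lax_v (m + 1) n) ^+ 2.
  have uu := mulr_ge0 (ltW u0) (ltW u0'); have vv := mulr_ge0 (ltW v0) (ltW v0').
  by rewrite eqrXn2 // => /eqP.
have c0 : s * (k1 m n - H) * (s * (k1 m (n + 1) - H)) != 0.
  by rewrite !mulf_neq0 ?gt_eqF ?subr_gt0.
apply: (mulfI c0).
transitivity ((s * (k1 m n - H) * lax_u m n ^+ 2) *
              (s * (k1 m (n + 1) - H) * lax_u m (n + 1) ^+ 2)); first by ring.
rewrite e e'.
transitivity ((s * (H - k2 m n) * lax_v m n ^+ 2) *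
              (s * (H - k2 (m + 1) n) * lax_v (m + 1) n ^+ 2)).
  by rewrite h h'.
transitivity (s ^+ 2 * ((H - k2 m n) * (H - k2 (m + 1) n)) *
  (lax_v m n * lax_v (m + 1) n) ^+ 2); first by ring.
by rewrite -pr; ring.
Qed.

(** Edge directions seen in the frame. The real and k components are fixed by u and v; the i and j
    components are free and supply a and b. *)
Let x1 m n := qmul (p m n) (qmul (e1 m n) (qconj (q m n))).
Let x2 m n := qmul (p m n) (qmul (e2 m n) (qconj (q m n))).
Definition lax_a0 m n := - (lax_al m n * qx (x1 m n)).
Definition lax_a3 m n := lax_al m n * qy (x1 m n).
Definition lax_b0 m n := lax_be m n * qy (x2 m n).
Definition lax_b3 m n := lax_be m n * qx (x2 m n).
Definition lax_Uhat m n :=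
  Uhat (lax_a0 m n) (lax_a3 m n) (lax_u m n) (lax_u m n)^-1.
Definition lax_Vhat m n :=
  Vhat (lax_b0 m n) (lax_b3 m n) (lax_v m n) (lax_v m n)^-1.

Lemma lax_x1 m n :
  lax_al m n * qw (x1 m n) = - (sg * (lax_u m n - (lax_u m n)^-1)) /\
  lax_al m n * qz (x1 m n) = - (cg * (lax_u m n + (lax_u m n)^-1)).
Proof.
have [_ _ hS hN] := edge1 m n; have [_ _ all kt _] := lax_uP m n.
have := spin_netP m n; rewrite [spin_net m n]surjective_pairing => fr.
exact: (frame_edge cs2 cs_cos cs_sin fr hS hN all kt).
Qed.

Lemma lax_x2 m n :
  lax_be m n * qw (x2 m n) = - (sg * (lax_v m n + (lax_v m n)^-1)) /\
  lax_be m n * qz (x2 m n) = - (cg * (lax_v m n - (lax_v m n)^-1)).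
Proof.
have [_ _ hS hN] := edge2 m n; have [_ _ all kt _] := lax_vP m n.
have := spin_netP m n; rewrite [spin_net m n]surjective_pairing => fr.
have [h1 h2] := frame_edge cs2 cs_cos cs_sin fr hS hN all kt.
by rewrite h1 h2 opprK.
Qed.

(** The two transition quaternions are - i conj(x1) and i x1, which differ only in the sign of the i
    component. In [Uhat] this is the sign of sg, so they are values of one matrix at conjugate
    points. *)
Lemma lax_Uhat_pq m n :
  lax_al m n *: qmul (p (m + 1) n) (qconj (p m n)) = lax_Uhat m n cg sg /\
  lax_al m n *: qmul (q (m + 1) n) (qconj (q m n)) = lax_Uhat m n cg (- sg).
Proof.
have [h1 h2] := lax_x1 m n.
rewrite /p /q spin_net_m /stU /spin_step /= -/(p m n) -/(q m n).
have -> : qmul (- qmul (Qi R) (qmul (q m n) (qconj (e1 m n)))) (qconj (p m n))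
    = - qmul (Qi R) (qconj (x1 m n)).
  by rewrite /x1 !qconjM qconjK qmulNl -!qmulA.
have -> : qmul (qmul (Qi R) (qmul (p m n) (e1 m n))) (qconj (q m n))
    = qmul (Qi R) (x1 m n) by rewrite /x1 -!qmulA.
rewrite /lax_Uhat /Uhat /lax_a0 /lax_a3; move: (x1 m n) h1 h2 => x h1 h2.
by split; apply: q_ext; rewrite /Qi; qexp; rewrite ?mulr0 ?mul0r; lra.
Qed.

Lemma lax_Vhat_pq m n :
  lax_be m n *: qmul (p m (n + 1)) (qconj (p m n)) = lax_Vhat m n cg sg /\
  lax_be m n *: qmul (q m (n + 1)) (qconj (q m n)) = lax_Vhat m n cg (- sg).
Proof.
have [h1 h2] := lax_x2 m n.
rewrite /p /q spin_net_n /stV /spin_step /= -/(p m n) -/(q m n).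
have -> : qmul (- qmul (- Qj R) (qmul (q m n) (qconj (e2 m n)))) (qconj (p m n))
    = qmul (Qj R) (qconj (x2 m n)).
  by rewrite /x2 !qconjM qconjK !qmulNl opprK -!qmulA.
have -> : qmul (qmul (- Qj R) (qmul (p m n) (e2 m n))) (qconj (q m n))
    = - qmul (Qj R) (x2 m n) by rewrite /x2 !qmulNl -!qmulA.
rewrite /lax_Vhat /Vhat /lax_b0 /lax_b3; move: (x2 m n) h1 h2 => x h1 h2.
by split; apply: q_ext; rewrite /Qj; qexp; lra.
Qed.

(** With p taken at the end and q at the start, every edge becomes a multiple of the fixed unit i
    (of j in the other direction); this form brings the closing of F into the compatibility
    condition. *)
Lemma spin_edge1 m n : qmul (p (m + 1) n) (qmul (dm F m n) (qconj (q m n))) =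
  - (l1 m n *: Qi R).
Proof.
have [_ fE _ _] := edge1 m n; have [_ qq] := spin_unit m n.
rewrite {1}fE qmulZl qmulZr /p spin_net_m /stU /spin_step /= -/(q m n).
rewrite qmulNl -!qmulA (qmulA (qconj (e1 m n))) qconj_mul dir1_unit scale1r.
by rewrite qmul1 qmul_conj qq scale1r qmulq1 scalerN.
Qed.

Lemma spin_edge2 m n : qmul (p m (n + 1)) (qmul (dn F m n) (qconj (q m n))) =
  - (l2 m n *: - Qj R).
Proof.
have [_ fE _ _] := edge2 m n; have [_ qq] := spin_unit m n.
rewrite {1}fE qmulZl qmulZr /p spin_net_n /stV /spin_step /= -/(q m n).
rewrite qmulNl -!qmulA (qmulA (qconj (e2 m n))) qconj_mul dir2_unit scale1r.
by rewrite qmul1 qmul_conj qq scale1r qmulq1 scalerN.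
Qed.

Lemma lax_hat_comm m n x y : x ^+ 2 + y ^+ 2 = 1 ->
  qmul (lax_Vhat (m + 1) n x y) (lax_Uhat m n x y) =
  qmul (lax_Uhat m (n + 1) x y) (lax_Vhat m n x y).
Proof.
move=> xy; have uv := lax_uv m n.
have [_ u0 ul _ _] := lax_uP m n; have [_ u0' ul' _ _] := lax_uP m (n + 1).
have [_ v0 vl _ _] := lax_vP m n; have [_ v0' vl' _ _] := lax_vP (m + 1) n.
have [U1 U2] := lax_Uhat_pq m n; have [U1' U2'] := lax_Uhat_pq m (n + 1).
have [V1 V2] := lax_Vhat_pq m n; have [V1' V2'] := lax_Vhat_pq (m + 1) n.
have [pp1 qq1] := spin_unit (m + 1) n; have [pp2 qq2] := spin_unit m (n + 1).
apply: (Uhat_Vhat_comm cs2 xy).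
- apply: (mulIf (x := lax_u m n * lax_v m n)); first by rewrite mulf_neq0 ?gt_eqF.
  transitivity (lax_v m n * lax_v (m + 1) n); last rewrite -uv.
    by field; rewrite gt_eqF.
  by field; rewrite gt_eqF.
- apply: (mulIf (x := lax_u m (n + 1) * lax_v (m + 1) n)).
    by rewrite mulf_neq0 ?gt_eqF.
  transitivity (lax_u m n * lax_u m (n + 1)); last rewrite uv.
    by field; rewrite gt_eqF.
  by field; rewrite gt_eqF.
(* At lambda_1 both products telescope to p_12 conj(p), with the same factor. *)
- rewrite -/(lax_Vhat (m + 1) n) -/(lax_Uhat m n) -/(lax_Uhat m (n + 1)).
  rewrite -/(lax_Vhat m n) -U1 -V1 -U1' -V1' !qmulZl !qmulZr -!qmulA.
  rewrite (qmulA (qconj (p (m + 1) n))) (qmulA (qconj (p m (n + 1)))).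
  rewrite !qconj_mul pp1 pp2 !scale1r !qmul1 lax_al_n lax_be_m !scalerA.
  by rewrite [X in X *: _]mulrC.
- rewrite -/(lax_Vhat (m + 1) n) -/(lax_Uhat m n) -/(lax_Uhat m (n + 1)).
  rewrite -/(lax_Vhat m n) -U2 -V1' -U1' -V2.
  rewrite lax_al_n lax_be_m in ul' vl' *.
  (* The closing of F, multiplied by p_12 on the left and conj(q) on the right, is the second
     condition; [Z1] to [Z4] are its four terms. *)
  have close : dm F m n + dn F (m + 1) n = dn F m n + dm F m (n + 1).
    by rewrite /dm /dn; qring.
  pose p12 := p (m + 1) (n + 1).
  have Z1 : l2 (m + 1) n *: qmul (- Qj R) (qmul (q (m + 1) n) (qconj (q m n)))
      = - qmul p12 (qmul (dn F (m + 1) n) (qconj (q m n))).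
    rewrite -qmulZl -[_ *: _]opprK -spin_edge2 qmulNl -!qmulA.
    by rewrite (qmulA (qconj (q (m + 1) n))) qconj_mul qq1 scale1r qmul1.
  have Z2 : l1 m n *: qmul (qmul p12 (qconj (p (m + 1) n))) (Qi R)
      = - qmul p12 (qmul (dm F m n) (qconj (q m n))).
    rewrite -qmulZr -[_ *: _]opprK -spin_edge1 qmulNr -!qmulA.
    by rewrite (qmulA (qconj (p (m + 1) n))) qconj_mul pp1 scale1r qmul1.
  have Z3 : l1 m (n + 1) *: qmul (Qi R) (qmul (q m (n + 1)) (qconj (q m n)))
      = - qmul p12 (qmul (dm F m (n + 1)) (qconj (q m n))).
    rewrite -qmulZl -[_ *: _]opprK -spin_edge1 qmulNl -!qmulA.
    by rewrite (qmulA (qconj (q m (n + 1)))) qconj_mul qq2 scale1r qmul1.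
  have Z4 : l2 m n *: qmul (qmul p12 (qconj (p m (n + 1)))) (- Qj R)
      = - qmul p12 (qmul (dn F m n) (qconj (q m n))).
    rewrite -qmulZr -[_ *: _]opprK -spin_edge2 qmulNr -!qmulA.
    by rewrite (qmulA (qconj (p m (n + 1)))) qconj_mul pp2 scale1r qmul1.
  have s20 : 2 * s != 0 by rewrite mulf_neq0 ?pnatr_eq0 ?gt_eqF.
  apply: (scalerI s20); rewrite !qmulZl !qmulZr !scalerDr !scalerA.
  rewrite -/p12.
  set c := lax_al m n * lax_be m n.
  transitivity (c *: (l2 (m + 1) n *: qmul (- Qj R) (qmul (q (m + 1) n) (qconj (q m n)))
    + l1 m n *: qmul (qmul p12 (qconj (p (m + 1) n))) (Qi R))).
    rewrite scalerDr !scalerA /c; congr (_ *: _ + _ *: _).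
      transitivity (lax_al m n * (2 * (s * lax_v (m + 1) n))); first ring.
      by rewrite -vl'; ring.
    transitivity (lax_be m n * (2 * (s * lax_u m n))); first ring.
      by rewrite -ul; ring.
  transitivity (c *: (l1 m (n + 1) *: qmul (Qi R) (qmul (q m (n + 1)) (qconj (q m n)))
    + l2 m n *: qmul (qmul p12 (qconj (p m (n + 1)))) (- Qj R))); last first.
    apply/esym.
    rewrite scalerDr !scalerA /c; congr (_ *: _ + _ *: _).
      transitivity (lax_be m n * (2 * (s * lax_u m (n + 1)))); first ring.
      by rewrite -ul'; ring.
    transitivity (lax_al m n * (2 * (s * lax_v m n))); first ring.
      by rewrite -vl; ring.
  rewrite Z1 Z2 Z3 Z4; congr (c *: _).
  transitivity (- qmul p12 (qmul (dm F m n + dn F (m + 1) n) (qconj (q m n)))).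
    by rewrite qmulDl qmulDr opprD addrC.
  by rewrite close qmulDl qmulDr opprD addrC.
Qed.

(** On the unit circle the determinant varies only by 2 cos (2 gamma), and its value at lambda_1 is
    the square of [lax_al]. *)
Lemma dot_Uhat m n x y : x ^+ 2 + y ^+ 2 = 1 ->
  dot (lax_Uhat m n x y) (lax_Uhat m n x y) =
  lax_al m n ^+ 2 + 2 * (x ^+ 2 - y ^+ 2) - 2 * (H * s).
Proof.
move=> xy; have [/(congr1 (fun z => dot z z)) + _] := lax_Uhat_pq m n.
have [p1 _] := spin_unit (m + 1) n; have [p1' _] := spin_unit m n.
have [_ u0 _ _ _] := lax_uP m n; have u0' : lax_u m n != 0 by rewrite gt_eqF.
rewrite dotZZ dot_qmul dot_conj p1 p1' !mulr1 -cs_cos /lax_Uhat /Uhat => ->.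
qexp; rewrite -cs2 in xy.
apply/eqP; rewrite -subr_eq0; apply/eqP.
transitivity ((x ^+ 2 + y ^+ 2 - (cg ^+ 2 + sg ^+ 2)) *
  (lax_u m n ^+ 2 + (lax_u m n)^-1 ^+ 2)); last by rewrite xy subrr mul0r.
by field.
Qed.

Lemma dot_Vhat m n x y : x ^+ 2 + y ^+ 2 = 1 ->
  dot (lax_Vhat m n x y) (lax_Vhat m n x y) =
  lax_be m n ^+ 2 - 2 * (x ^+ 2 - y ^+ 2) + 2 * (H * s).
Proof.
move=> xy; have [/(congr1 (fun z => dot z z)) + _] := lax_Vhat_pq m n.
have [p1 _] := spin_unit m (n + 1); have [p1' _] := spin_unit m n.
have [_ u0 _ _ _] := lax_vP m n; have u0' : lax_v m n != 0 by rewrite gt_eqF.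
rewrite dotZZ dot_qmul dot_conj p1 p1' !mulr1 -cs_cos /lax_Vhat /Vhat => ->.
qexp; rewrite -cs2 in xy.
apply/eqP; rewrite -subr_eq0; apply/eqP.
transitivity ((x ^+ 2 + y ^+ 2 - (cg ^+ 2 + sg ^+ 2)) *
  (lax_v m n ^+ 2 + (lax_v m n)^-1 ^+ 2)); last by rewrite xy subrr mul0r.
by field.
Qed.

Lemma frame_inj m n (a b : E4) :
  qmul (p m n) (qmul a (qconj (q m n))) = qmul (p m n) (qmul b (qconj (q m n))) ->
  a = b.
Proof.
have [pp qq] := spin_unit m n.
move/(congr1 (fun z => qmul (qmul (qconj (p m n)) z) (q m n))).
by rewrite !unit_mulK // !unit_mulVKr.
Qed.

Lemma x_unit m n : dot (x1 m n) (x1 m n) = 1 /\ dot (x2 m n) (x2 m n) = 1.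
Proof.
have [pp qq] := spin_unit m n.
by rewrite /x1 /x2 !dot_frame // dir1_unit dir2_unit.
Qed.

(** Vanishing forces lambda = i or - i, u = 1 and a = 0; then x1 is a multiple of k, and the edge is
    the one excluded by [off_dual]. *)
Lemma Uhat_neq0 m n x y : x ^+ 2 + y ^+ 2 = 1 -> lax_Uhat m n x y <> 0.
Proof.
move=> xy h; have [a0 u0 all _ _] := lax_uP m n; have [hw hz] := lax_x1 m n.
have a0' : lax_al m n != 0 by rewrite gt_eqF.
have u0' : lax_u m n != 0 by rewrite gt_eqF.
have ui0 : 0 < (lax_u m n)^-1 by rewrite invr_gt0.
have := congr1 (@qw R) h; have := congr1 (@qx R) h.
have := congr1 (@qy R) h; have := congr1 (@qz R) h.
rewrite /lax_Uhat /Uhat !qE /lax_a0 /lax_a3.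
move=> /eqP; rewrite mulf_eq0 (negPf a0') => /eqP y0.
move=> /eqP; rewrite mulf_eq0 [X in _ || X]gt_eqF ?addr_gt0 // orbF => /eqP x0.
move=> ey /eqP; rewrite oppr_eq0 mulf_eq0 (negPf a0') => /eqP x0'.
have uu : lax_u m n = (lax_u m n)^-1.
  apply/eqP; rewrite -subr_eq0; move/eqP: ey; rewrite mulf_eq0 => /orP[/eqP y0'|//].
  by move: xy; rewrite x0 y0' expr0n addr0 => /eqP; rewrite eq_sym oner_eq0.
have u1 : lax_u m n = 1.
  apply/eqP; rewrite -sqrp_eq1 ?ltW // expr2 {2}uu mulfV //.
have [_ fE _ _] := edge1 m n; have [N1 _] := off_dual m n; apply: N1.
(* In the frame S and N become M and - k M, so the equality is one between elements of the span of 1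
   and k. *)
apply: (@frame_inj m n).
have [_ _ hS hN] := spin_netP m n; rewrite -/(p m n) -/(q m n) in hS hN.
have [xx _] := x_unit m n.
rewrite {1}fE qmulZl qmulZr -/(x1 m n) qmulDl qmulDr.
rewrite (qmulZl _ (S m n)) (qmulZl _ (N m n)) !(qmulZr _ (p m n)) hS hN.
move: hw hz all xx; rewrite u1 invr1 subrr mulr0 oppr0 mulr1 => hw hz all.
have w0 : qw (x1 m n) = 0.
  by apply/eqP; move/eqP: hw; rewrite mulf_eq0 (negPf a0').
rewrite dotE x0' y0 w0 !mulr0 !add0r addr0 => xx.
have al2 : lax_al m n ^+ 2 = 4 * cg ^+ 2.
  transitivity (lax_al m n ^+ 2 * (qz (x1 m n) * qz (x1 m n))).
    by rewrite xx mulr1.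
  transitivity ((lax_al m n * qz (x1 m n)) ^+ 2); first by ring.
  by rewrite hz; ring.
move: (x1 m n) x0' y0 w0 hz => X x0' y0 w0 hz.
apply: q_ext; rewrite ?qE ?x0' ?y0 ?w0 ?mulr0 ?oppr0 ?mulr0 ?addr0 //.
  rewrite -cs_cos -[X in _ - X]cs2.
  transitivity (sg * (s - 2 * (cg * sg))); last by ring.
  rewrite cs_sin; transitivity (s * (sg - eps * sg)); last by ring.
  by rewrite eps_sg; ring.
have al20 : lax_al m n ^+ 2 != 0 by rewrite expf_neq0.
apply: (mulfI al20); rewrite -cs_cos.
transitivity ((lax_al m n * l1 m n) * (lax_al m n * qz X)); first by ring.
rewrite all hz al2.
transitivity (- (4 * cg) * (s * (cg ^+ 2 + sg ^+ 2))); first by rewrite cs2; ring.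
transitivity (- (4 * cg) * (s * cg ^+ 2 + sg ^+ 2 * (2 * (cg * sg)))); last first.
  by rewrite -[X in _ - X]cs2; ring.
transitivity (- (4 * cg) * (s * cg ^+ 2 + s * sg * (eps * sg))).
  by rewrite eps_sg; ring.
by rewrite cs_sin; ring.
Qed.

(** Here lambda = 1 or - 1, v = 1 and b = 0. Then the square of [lax_be] is 4 sg^2, so sg is
    non-zero and eps = 1: this case can arise only in S^3. *)
Lemma Vhat_neq0 m n x y : x ^+ 2 + y ^+ 2 = 1 -> lax_Vhat m n x y <> 0.
Proof.
move=> xy h; have [a0 u0 all _ _] := lax_vP m n; have [hw hz] := lax_x2 m n.
have a0' : lax_be m n != 0 by rewrite gt_eqF.
have u0' : lax_v m n != 0 by rewrite gt_eqF.
have ui0 : 0 < (lax_v m n)^-1 by rewrite invr_gt0.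
have := congr1 (@qw R) h; have := congr1 (@qx R) h.
have := congr1 (@qy R) h; have := congr1 (@qz R) h.
rewrite /lax_Vhat /Vhat !qE /lax_b0 /lax_b3.
move=> /eqP; rewrite mulf_eq0 (negPf a0') => /eqP x0'.
move=> /eqP; rewrite oppr_eq0 mulf_eq0 [X in _ || X]gt_eqF ?addr_gt0 // orbF => /eqP ey.
move=> x0 /eqP; rewrite mulf_eq0 (negPf a0') => /eqP y0.
have uu : lax_v m n = (lax_v m n)^-1.
  apply/eqP; rewrite -subr_eq0; move/eqP: x0; rewrite mulf_eq0 => /orP[/eqP x0|//].
  by move: xy; rewrite x0 ey expr0n addr0 => /eqP; rewrite eq_sym oner_eq0.
have u1 : lax_v m n = 1.
  apply/eqP; rewrite -sqrp_eq1 ?ltW // expr2 {2}uu mulfV //.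
have [_ fE _ _] := edge2 m n; have [_ N1] := off_dual m n; apply: N1.
apply: (@frame_inj m n).
have [_ _ hS hN] := spin_netP m n; rewrite -/(p m n) -/(q m n) in hS hN.
have [_ xx] := x_unit m n.
rewrite {1}fE qmulZl qmulZr -/(x2 m n) qmulDl qmulDr qmulNl qmulNr.
rewrite (qmulZl _ (S m n)) (qmulZl _ (N m n)) !(qmulZr _ (p m n)) hS hN.
move: hw hz all xx; rewrite u1 invr1 subrr mulr0 oppr0 mulr1 => hw hz all.
have z0 : qz (x2 m n) = 0.
  by apply/eqP; move/eqP: hz; rewrite mulf_eq0 (negPf a0').
rewrite dotE x0' y0 z0 !mulr0 !add0r => xx.
have be2 : lax_be m n ^+ 2 = 4 * sg ^+ 2.
  transitivity (lax_be m n ^+ 2 * (qw (x2 m n) * qw (x2 m n))).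
    by rewrite xx mulr1.
  transitivity ((lax_be m n * qw (x2 m n)) ^+ 2); first by ring.
  by rewrite hw; ring.
have be20 : lax_be m n ^+ 2 != 0 by rewrite expf_neq0.
have eps1 : eps = 1.
  have sg0 : sg != 0.
    by apply: contraNneq be20 => sg0; rewrite be2 sg0 expr0n mulr0.
  by apply: (mulIf sg0); rewrite eps_sg mul1r.
move: cs_sin; rewrite eps1 mul1r => cs_sin1.
have hs1 : H * s + 1 = 2 * cg ^+ 2 by move: cs2 cs_cos; lra.
move: (x2 m n) x0' y0 z0 hw => X x0' y0 z0 hw.
apply: q_ext; rewrite ?qE ?x0' ?y0 ?z0 ?mulr0 ?oppr0 ?mulr0 ?subr0 //; last first.
  by rewrite hs1 -cs_sin1; ring.
apply: (mulfI be20); rewrite hs1.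
transitivity ((lax_be m n * l2 m n) * (lax_be m n * qw X)); first by ring.
rewrite all hw be2.
transitivity (- (4 * sg) * (s * (cg ^+ 2 + sg ^+ 2))); first by rewrite cs2; ring.
by rewrite -cs_sin1; ring.
Qed.


(** * Normalized Lax matrices and the frame on the whole loop *)

Local Notation re := complex.Re.
Local Notation im := complex.Im.

Definition lax_alpha m n (z : R[i]) : R :=
  Num.sqrt (lax_al m n ^+ 2 + 2 * (re z ^+ 2 - im z ^+ 2) - 2 * (H * s)).
Definition lax_beta m n (z : R[i]) : R :=
  Num.sqrt (lax_be m n ^+ 2 - 2 * (re z ^+ 2 - im z ^+ 2) + 2 * (H * s)).
Definition lax_Uq m n (z : R[i]) : E4 :=
  (lax_alpha m n z)^-1 *: lax_Uhat m n (re z) (im z).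
Definition lax_Vq m n (z : R[i]) : E4 :=
  (lax_beta m n z)^-1 *: lax_Vhat m n (re z) (im z).

Lemma lax_alphaE m n z : re z ^+ 2 + im z ^+ 2 = 1 ->
  lax_alpha m n z = qlen (lax_Uhat m n (re z) (im z)).
Proof. by move=> h; rewrite /lax_alpha /qlen dot_Uhat. Qed.

Lemma lax_betaE m n z : re z ^+ 2 + im z ^+ 2 = 1 ->
  lax_beta m n z = qlen (lax_Vhat m n (re z) (im z)).
Proof. by move=> h; rewrite /lax_beta /qlen dot_Vhat. Qed.

Lemma lax_alpha_gt0 m n z : re z ^+ 2 + im z ^+ 2 = 1 -> 0 < lax_alpha m n z.
Proof. by move=> h; rewrite lax_alphaE //; exact/qlen_gt0/Uhat_neq0. Qed.

Lemma lax_beta_gt0 m n z : re z ^+ 2 + im z ^+ 2 = 1 -> 0 < lax_beta m n z.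
Proof. by move=> h; rewrite lax_betaE //; exact/qlen_gt0/Vhat_neq0. Qed.

Lemma lax_Uq_unit m n z : re z ^+ 2 + im z ^+ 2 = 1 ->
  dot (lax_Uq m n z) (lax_Uq m n z) = 1.
Proof. by move=> h; rewrite /lax_Uq lax_alphaE //; exact/dot_qdir/Uhat_neq0. Qed.

Lemma lax_Vq_unit m n z : re z ^+ 2 + im z ^+ 2 = 1 ->
  dot (lax_Vq m n z) (lax_Vq m n z) = 1.
Proof. by move=> h; rewrite /lax_Vq lax_betaE //; exact/dot_qdir/Vhat_neq0. Qed.

Lemma lax_alpha_n m n z : lax_alpha m (n + 1) z = lax_alpha m n z.
Proof. by rewrite /lax_alpha lax_al_n. Qed.

Lemma lax_beta_m m n z : lax_beta (m + 1) n z = lax_beta m n z.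
Proof. by rewrite /lax_beta lax_be_m. Qed.

Lemma lax_q_comm m n z : re z ^+ 2 + im z ^+ 2 = 1 ->
  qmul (lax_Vq (m + 1) n z) (lax_Uq m n z) =
  qmul (lax_Uq m (n + 1) z) (lax_Vq m n z).
Proof.
move=> h; rewrite /lax_Uq /lax_Vq lax_alpha_n lax_beta_m.
rewrite !(qmulZl, qmulZr) !scalerA (lax_hat_comm m n h).
by congr (_ *: _); rewrite mulrC.
Qed.

Variables (g : R) (psi0 : R[i] -> E4).
Hypotheses (cgE : cg = cos g) (sgE : sg = sin g).
Hypothesis psi0_unit : forall z, dot (psi0 z) (psi0 z) = 1.
Hypothesis psi0_twist : forall z, psi0 (- z) = qtwist (psi0 z).
Hypothesis psi0_derive : forall t,
  exists d, q_is_derive (fun x => psi0 (cis x)) t d.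
Hypotheses (psi0_p : psi0 (cis g) = p0) (psi0_q : psi0 (cis (- g)) = q0).

Definition lax_psi m n (z : R[i]) : E4 :=
  grid (fun m n => qmul (lax_Uq m n z)) (fun m n => qmul (qconj (lax_Uq m n z)))
       (fun m n => qmul (lax_Vq m n z)) (fun m n => qmul (qconj (lax_Vq m n z)))
       (psi0 z) m n.

Lemma lax_psi_n m n z : re z ^+ 2 + im z ^+ 2 = 1 ->
  lax_psi m (n + 1) z = qmul (lax_Vq m n z) (lax_psi m n z).
Proof.
by move=> h; apply: grid_n => {}m {}n x; rewrite unit_mulVK // lax_Vq_unit.
Qed.

Lemma lax_psi_m m n z : re z ^+ 2 + im z ^+ 2 = 1 ->
  lax_psi (m + 1) n z = qmul (lax_Uq m n z) (lax_psi m n z).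
Proof.
move=> h; apply: grid_m => {}m {}n x.
- by rewrite unit_mulVK // lax_Uq_unit.
- by rewrite unit_mulK // lax_Vq_unit.
- by rewrite unit_mulVK // lax_Vq_unit.
- by rewrite !qmulA lax_q_comm.
Qed.

Lemma lax_psi_unit m n z : re z ^+ 2 + im z ^+ 2 = 1 ->
  dot (lax_psi m n z) (lax_psi m n z) = 1.
Proof.
move=> h; move: m n; apply: int2_shift_ind => [|m n|m n]; first exact: psi0_unit.
  by rewrite lax_psi_m // dot_qmul lax_Uq_unit // mul1r.
by rewrite lax_psi_n // dot_qmul lax_Vq_unit // mul1r.
Qed.

Lemma lax_Uq_twist m n z : lax_Uq m n (- z) = qtwist (lax_Uq m n z).
Proof.
case: z => x y; rewrite /lax_Uq /lax_alpha /lax_Uhat /Uhat /qtwist /= !sqrrN.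
by apply: q_ext; rewrite ?qE; ring.
Qed.

Lemma lax_Vq_twist m n z : lax_Vq m n (- z) = qtwist (lax_Vq m n z).
Proof.
case: z => x y; rewrite /lax_Vq /lax_beta /lax_Vhat /Vhat /qtwist /= !sqrrN.
by apply: q_ext; rewrite ?qE; ring.
Qed.

Lemma lax_psi_twist m n z : re z ^+ 2 + im z ^+ 2 = 1 ->
  lax_psi m n (- z) = qtwist (lax_psi m n z).
Proof.
move=> h; have h' : re (- z) ^+ 2 + im (- z) ^+ 2 = 1.
  by rewrite -h; case: (z) => x y /=; rewrite !sqrrN.
move: m n; apply: int2_shift_ind => [|m n|m n]; first exact: psi0_twist.
  rewrite !lax_psi_m // lax_Uq_twist qtwistM; split=> [->//|].
  by apply: unit_mul_inj; rewrite dot_twist lax_Uq_unit.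
rewrite !lax_psi_n // lax_Vq_twist qtwistM; split=> [->//|].
by apply: unit_mul_inj; rewrite dot_twist lax_Vq_unit.
Qed.

Lemma lax_Uq_g m n : lax_Uq m n (cis g) = qmul (p (m + 1) n) (qconj (p m n)) /\
  lax_Uq m n (cis (- g)) = qmul (q (m + 1) n) (qconj (q m n)).
Proof.
have [a0 _ _ _ _] := lax_uP m n; have [h1 h2] := lax_Uhat_pq m n.
rewrite /lax_Uq /lax_alpha /= cosN sinN -cgE -sgE sqrrN cs_cos addrK.
by rewrite sqrtr_sqr gtr0_norm // -h1 -h2 !scalerA mulVf ?gt_eqF // !scale1r.
Qed.

Lemma lax_Vq_g m n : lax_Vq m n (cis g) = qmul (p m (n + 1)) (qconj (p m n)) /\
  lax_Vq m n (cis (- g)) = qmul (q m (n + 1)) (qconj (q m n)).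
Proof.
have [a0 _ _ _ _] := lax_vP m n; have [h1 h2] := lax_Vhat_pq m n.
rewrite /lax_Vq /lax_beta /= cosN sinN -cgE -sgE sqrrN cs_cos subrK.
by rewrite sqrtr_sqr gtr0_norm // -h1 -h2 !scalerA mulVf ?gt_eqF // !scale1r.
Qed.

Lemma lax_psi_p m n : lax_psi m n (cis g) = p m n.
Proof.
move: m n; apply: int2_shift_ind => // m n; have [pp _] := spin_unit m n.
  have [e _] := lax_Uq_g m n; have u := lax_Uq_unit m n (cis_unit g).
  rewrite lax_psi_m ?cis_unit // -[p (m + 1) n](unit_mulVKr _ pp) -e.
  by split=> [->//|]; exact: unit_mul_inj.
have [e _] := lax_Vq_g m n; have u := lax_Vq_unit m n (cis_unit g).
rewrite lax_psi_n ?cis_unit // -[p m (n + 1)](unit_mulVKr _ pp) -e.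
by split=> [->//|]; exact: unit_mul_inj.
Qed.

Lemma lax_psi_q m n : lax_psi m n (cis (- g)) = q m n.
Proof.
move: m n; apply: int2_shift_ind => // m n; have [_ qq] := spin_unit m n.
  have [_ e] := lax_Uq_g m n; have u := lax_Uq_unit m n (cis_unit (- g)).
  rewrite lax_psi_m ?cis_unit // -[q (m + 1) n](unit_mulVKr _ qq) -e.
  by split=> [->//|]; exact: unit_mul_inj.
have [_ e] := lax_Vq_g m n; have u := lax_Vq_unit m n (cis_unit (- g)).
rewrite lax_psi_n ?cis_unit // -[q m (n + 1)](unit_mulVKr _ qq) -e.
by split=> [->//|]; exact: unit_mul_inj.
Qed.

(** At gamma = 0 the function cos (2 gamma) is stationary, hence so is alpha, and only the i
    component of the numerator has a non-zero derivative. *)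
Lemma lax_Uq_derive m n t : exists d,
  [/\ q_is_derive (fun x => lax_Uq m n (cis x)) t d &
      t = 0 -> d = ((lax_alpha m n (cis 0))^-1 * (lax_u m n - (lax_u m n)^-1)) *: Qi R].
Proof.
have a0 := lax_alpha_gt0 m n (cis_unit t).
have hf := isdD (isdD (isdK t (lax_al m n ^+ 2)) (isdM (isdK t 2) (isd_cos2 t)))
  (isdK t (- (2 * (H * s)))).
have ha := isd_sqrtV (f := fun x => lax_al m n ^+ 2 +
  2 * (cos x ^+ 2 - sin x ^+ 2) - 2 * (H * s)) a0 hf.
have hU : q_is_derive (fun x => lax_Uhat m n (cos x) (sin x)) t
  (mkq 0 (cos t * (lax_u m n - (lax_u m n)^-1))
         (- sin t * (lax_u m n + (lax_u m n)^-1)) 0).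
  split; rewrite ?qE; under eq_fun do rewrite ?qE; try exact: isdK.
  - by apply: (isd_eq (isdM (is_derive_sin t) (isdK t _))); ring.
  - by apply: (isd_eq (isdM (is_derive_cos t) (isdK t _))); ring.
eexists; split; first exact: (qd_scale ha hU).
move=> ->; rewrite /Qi cos0 sin0 /lax_alpha /= cos0 sin0.
by apply: q_ext; rewrite ?qE; ring.
Qed.

Lemma lax_Vq_derive m n t : exists d,
  [/\ q_is_derive (fun x => lax_Vq m n (cis x)) t d &
      t = 0 -> d = - ((lax_beta m n (cis 0))^-1 * (lax_v m n + (lax_v m n)^-1)) *: Qj R].
Proof.
have a0 := lax_beta_gt0 m n (cis_unit t).
have hf := isdD (isdB (isdK t (lax_be m n ^+ 2)) (isdM (isdK t 2) (isd_cos2 t)))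
  (isdK t (2 * (H * s))).
have ha := isd_sqrtV (f := fun x => lax_be m n ^+ 2 -
  2 * (cos x ^+ 2 - sin x ^+ 2) + 2 * (H * s)) a0 hf.
have hU : q_is_derive (fun x => lax_Vhat m n (cos x) (sin x)) t
  (mkq 0 (- sin t * (lax_v m n - (lax_v m n)^-1))
         (- (cos t * (lax_v m n + (lax_v m n)^-1))) 0).
  split; rewrite ?qE; under eq_fun do rewrite ?qE; try exact: isdK.
  - by apply: (isd_eq (isdM (is_derive_cos t) (isdK t _))); ring.
  - by apply: (isd_eq (isdN (isdM (is_derive_sin t) (isdK t _)))); ring.
eexists; split; first exact: (qd_scale ha hU).
move=> ->; rewrite /Qj cos0 sin0 /lax_beta /= cos0 sin0.
by apply: q_ext; rewrite ?qE; ring.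
Qed.

Lemma lax_psi_derive m n t :
  exists d, q_is_derive (fun x => lax_psi m n (cis x)) t d.
Proof.
move: m n; apply: int2_shift_ind => [|m n|m n]; first exact: psi0_derive.
  have [d [hd _]] := lax_Uq_derive m n t.
  have E1 : (fun x => lax_psi (m + 1) n (cis x)) =
      fun x => qmul (lax_Uq m n (cis x)) (lax_psi m n (cis x)).
    by apply/funext => x; rewrite lax_psi_m ?cis_unit.
  have E2 : (fun x => lax_psi m n (cis x)) =
      fun x => qmul (qconj (lax_Uq m n (cis x))) (lax_psi (m + 1) n (cis x)).
    by apply/funext => x; rewrite lax_psi_m ?cis_unit // unit_mulK ?lax_Uq_unit ?cis_unit.
  split=> [[d' hd']|[d' hd']]; first by rewrite E1; eexists; exact: qd_mul hd hd'.
  by rewrite E2; eexists; exact: qd_mul (qd_conj hd) hd'.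
have [d [hd _]] := lax_Vq_derive m n t.
have E1 : (fun x => lax_psi m (n + 1) (cis x)) =
    fun x => qmul (lax_Vq m n (cis x)) (lax_psi m n (cis x)).
  by apply/funext => x; rewrite lax_psi_n ?cis_unit.
have E2 : (fun x => lax_psi m n (cis x)) =
    fun x => qmul (qconj (lax_Vq m n (cis x))) (lax_psi m (n + 1) (cis x)).
  by apply/funext => x; rewrite lax_psi_n ?cis_unit // unit_mulK ?lax_Vq_unit ?cis_unit.
split=> [[d' hd']|[d' hd']]; first by rewrite E1; eexists; exact: qd_mul hd hd'.
by rewrite E2; eexists; exact: qd_mul (qd_conj hd) hd'.
Qed.

(* The derivative of the frame at lambda = 1 integrates the middle net F + N/2,
   whose edges are the derivatives of the Lax matrices. *)
Lemma lax_psi_derive0 : g = 0 -> s = 1 -> H = 1 -> (forall m n, S m n = q1 R) ->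
  q_is_derive (fun x => psi0 (cis x)) 0
    (- qmul p0 (F 0 0 + 2^-1 *: N 0 0)) ->
  forall m n, q_is_derive (fun x => lax_psi m n (cis x)) 0
    (- qmul (p m n) (F m n + 2^-1 *: N m n)).
Proof.
move=> g0 s1 H1 S1 d0 m n.
have cg1 : cg = 1 by rewrite cgE g0 cos0.
have sg0 : sg = 0 by rewrite sgE g0 sin0.
(* At gamma = 0 the constant M is 1, so the frame condition reads p conj(q) = 1. *)
have pqE i j : q i j = p i j.
  have [pp qq + _] := spin_netP i j; rewrite -/(p i j) -/(q i j) S1 qmul1 cg1 sg0.
  move/(congr1 (fun z => qmul z (q i j))).
  by rewrite unit_mulVKr // -/(q1 R) qmul1 => ->.
pose c i j := F i j + 2^-1 *: N i j.
suff H0 : forall i j d, q_is_derive (fun x => lax_psi i j (cis x)) 0 d ->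
    d = - qmul (p i j) (c i j).
  by have [d hd] := lax_psi_derive m n 0; rewrite -/(c m n) -(H0 _ _ _ hd).
have key (u0 : E4) (pp cc q' : E4) : dot u0 u0 = 1 -> qmul u0 pp = q' ->
   forall d, (d = - qmul pp cc <-> qmul u0 d = - qmul q' cc).
  move=> u01 <- d; rewrite -qmulA -[- qmul u0 _]qmulNr; split=> [->//|].
  exact: unit_mul_inj u01 _ _.
move: m n => _ _; apply: int2_shift_ind => [d hd|m n|m n].
- exact: qd_unique hd d0.
- have [dU [hU /(_ erefl) dUE]] := lax_Uq_derive m n 0.
  have [d hd] := lax_psi_derive m n 0.
  have hd1 : q_is_derive (fun x => lax_psi (m + 1) n (cis x)) 0
      (qmul dU (p m n) + qmul (lax_Uq m n (cis 0)) d).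
    have -> : (fun x => lax_psi (m + 1) n (cis x)) =
        fun x => qmul (lax_Uq m n (cis x)) (lax_psi m n (cis x)).
      by apply/funext => x; rewrite lax_psi_m ?cis_unit.
    by have := qd_mul hU hd; rewrite -[X in lax_psi m n (cis X)]g0 lax_psi_p.
  have [pp _] := spin_unit m n.
  have Up : qmul (lax_Uq m n (cis 0)) (p m n) = p (m + 1) n.
    by have [+ _] := lax_Uq_g m n; rewrite g0 => ->; rewrite unit_mulVKr.
  have dUp : qmul dU (p m n) = - qmul (p (m + 1) n) (c (m + 1) n - c m n).
    have [a0 u0 al_l ku _] := lax_uP m n; have [_ _ dN _ _] := framed_dm framed m n.
    have al1 : lax_alpha m n (cis 0) = lax_al m n.
      by rewrite /lax_alpha /= -g0 -cgE -sgE cs_cos addrK sqrtr_sqr gtr0_norm.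
    have -> : c (m + 1) n - c m n = (1 - k1 m n / 2) *: dm F m n.
      transitivity (dm F m n + 2^-1 *: dm N m n); first by rewrite /c /dm; qring.
      by rewrite dN scalerA -{1}[dm F m n]scale1r -scalerDl; congr (_ *: _); rewrite /k1; ring.
    have pe : qmul (p (m + 1) n) (dm F m n) = - (l1 m n *: qmul (Qi R) (p m n)).
      have := congr1 (fun z => qmul z (p m n)) (spin_edge1 m n).
      by rewrite pqE -!qmulA qconj_mul pp scale1r qmulq1 qmulNl qmulZl.
    rewrite qmulZr pe scalerN opprK scalerA dUE qmulZl al1; congr (_ *: _).
    have a0' : lax_al m n != 0 by rewrite gt_eqF.
    apply: (mulfI a0'); rewrite mulrA mulfV // mul1r.
    (* For H = s = 1 one has k1 u = u + 1 / u and alpha l1 = 2 u, so the edge of F + N/2 yields 2 u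
       - k1 u = u - 1 / u. *)
    transitivity ((1 - k1 m n / 2) * (lax_al m n * l1 m n)); last by ring.
    rewrite al_l s1 mul1r; move: ku; rewrite s1 H1 mulr1 mul1r => ku.
    by transitivity (2 * lax_u m n - k1 m n * lax_u m n); [rewrite ku; ring|field].
  have kk := key _ _ (c m n) _ (lax_Uq_unit m n (cis_unit 0)) Up d.
  split=> h d' hd'.
    rewrite (qd_unique hd' hd1) dUp (kk.1 (h _ hd)) -opprD -qmulDr.
    by rewrite subrK.
  rewrite (qd_unique hd' hd); apply/kk.
  have := h _ hd1; rewrite dUp => /eqP; rewrite -subr_eq0 opprK => /eqP e.
  apply/eqP; rewrite -subr_eq0 opprK -{}e; apply/eqP.
  rewrite addrAC [RHS]addrC; congr (_ + _); rewrite addrC -qmulNr -qmulDr.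
  by congr (qmul _ _); rewrite opprB addrC subrK.
- have [dV [hV /(_ erefl) dVE]] := lax_Vq_derive m n 0.
  have [d hd] := lax_psi_derive m n 0.
  have hd1 : q_is_derive (fun x => lax_psi m (n + 1) (cis x)) 0
      (qmul dV (p m n) + qmul (lax_Vq m n (cis 0)) d).
    have -> : (fun x => lax_psi m (n + 1) (cis x)) =
        fun x => qmul (lax_Vq m n (cis x)) (lax_psi m n (cis x)).
      by apply/funext => x; rewrite lax_psi_n ?cis_unit.
    by have := qd_mul hV hd; rewrite -[X in lax_psi m n (cis X)]g0 lax_psi_p.
  have [pp _] := spin_unit m n.
  have Vp : qmul (lax_Vq m n (cis 0)) (p m n) = p m (n + 1).
    by have [+ _] := lax_Vq_g m n; rewrite g0 => ->; rewrite unit_mulVKr.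
  have dVp : qmul dV (p m n) = - qmul (p m (n + 1)) (c m (n + 1) - c m n).
    have [a0 u0 al_l ku _] := lax_vP m n; have [_ _ dN _ _] := framed_dn framed m n.
    have al1 : lax_beta m n (cis 0) = lax_be m n.
      by rewrite /lax_beta /= -g0 -cgE -sgE cs_cos subrK sqrtr_sqr gtr0_norm.
    have -> : c m (n + 1) - c m n = (1 - k2 m n / 2) *: dn F m n.
      transitivity (dn F m n + 2^-1 *: dn N m n); first by rewrite /c /dn; qring.
      by rewrite dN scalerA -{1}[dn F m n]scale1r -scalerDl; congr (_ *: _); rewrite /k2; ring.
    have pe : qmul (p m (n + 1)) (dn F m n) = - (l2 m n *: - qmul (Qj R) (p m n)).
      have := congr1 (fun z => qmul z (p m n)) (spin_edge2 m n).
      by rewrite pqE -!qmulA qconj_mul pp scale1r qmulq1 !(qmulNl, qmulZl).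
    rewrite qmulZr pe !scalerN opprK scalerA.
    rewrite dVE scaleNr qmulNl qmulZl al1; congr (- (_ *: _)).
    have a0' : lax_be m n != 0 by rewrite gt_eqF.
    apply: (mulfI a0'); rewrite mulrA mulfV // mul1r.
    transitivity ((1 - k2 m n / 2) * (lax_be m n * l2 m n)); last by ring.
    rewrite al_l s1 mul1r; move: ku; rewrite s1 H1 mulr1 mul1r => ku.
    by transitivity (2 * lax_v m n - k2 m n * lax_v m n); [rewrite ku; ring|field].
  have kk := key _ _ (c m n) _ (lax_Vq_unit m n (cis_unit 0)) Vp d.
  split=> h d' hd'.
    rewrite (qd_unique hd' hd1) dVp (kk.1 (h _ hd)) -opprD -qmulDr.
    by rewrite subrK.
  rewrite (qd_unique hd' hd); apply/kk.
  have := h _ hd1; rewrite dVp => /eqP; rewrite -subr_eq0 opprK => /eqP e.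
  apply/eqP; rewrite -subr_eq0 opprK -{}e; apply/eqP.
  rewrite addrAC [RHS]addrC; congr (_ + _); rewrite addrC -qmulNr -qmulDr.
  by congr (qmul _ _); rewrite opprB addrC subrK.
Qed.

Definition lax_net_data : lax_data R := LaxData
  (fun m n => (lax_a0 m n -i* lax_a3 m n)%C)
  (fun m n => (lax_b0 m n -i* lax_b3 m n)%C)
  lax_u lax_v lax_alpha lax_beta.

Lemma norm1_re_im (z : R[i]) : `|z| = 1 -> re z ^+ 2 + im z ^+ 2 = 1.
Proof.
rewrite normc_def => /(congr1 (@complex.Re R)) /= h.
rewrite -[LHS]sqr_sqrtr ?addr_ge0 ?sqr_ge0 //.
by rewrite h expr1n.
Qed.

Lemma inv_unit_complex (z : R[i]) : re z ^+ 2 + im z ^+ 2 = 1 ->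
  z^-1 = (re z -i* im z)%C.
Proof.
move=> h; apply: mulr1_eq; case: z h => x y /= h.
by apply: complex_ext => /=; rewrite -?h; ring.
Qed.

Lemma laxU_quat m n z : re z ^+ 2 + im z ^+ 2 = 1 ->
  laxU lax_net_data m n z = quat (lax_Uq m n z).
Proof.
move=> h; rewrite /laxU /lax_Uq quatZ /= -fmorphV; congr (_ *: _).
rewrite (inv_unit_complex h) -fmorphV quatE /lax_Uhat /Uhat ?qE.
case: z {h} => x y /=.
by congr mx2; apply: complex_ext => /=; ring.
Qed.

Lemma laxV_quat m n z : re z ^+ 2 + im z ^+ 2 = 1 ->
  laxV lax_net_data m n z = quat (lax_Vq m n z).
Proof.
move=> h; rewrite /laxV /lax_Vq quatZ /= -fmorphV; congr (_ *: _).
rewrite (inv_unit_complex h) -fmorphV quatE /lax_Vhat /Vhat ?qE.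
case: z {h} => x y /=.
by congr mx2; apply: complex_ext => /=; ring.
Qed.

Lemma lax_net_pair : lax_pair lax_net_data.
Proof.
move=> m n; have [_ u0 _ _ _] := lax_uP m n; have [_ v0 _ _ _] := lax_vP m n.
split; [exact: u0|exact: v0|move=> z /norm1_re_im h; split].
- by rewrite (laxU_quat m n h) det_quat (lax_Uq_unit m n h).
- by rewrite (laxV_quat m n h) det_quat (lax_Vq_unit m n h).
- exact: lax_alpha_n.
- exact: lax_beta_m.
- rewrite (laxU_quat m n h) (laxV_quat m n h) (laxU_quat m (n + 1) h).
  by rewrite (laxV_quat (m + 1) n h) -!quatM (lax_q_comm m n h).
Qed.

Lemma lax_net_frame : frame lax_net_data (fun m n z => quat (lax_psi m n z)).
Proof.
move=> m n; split=> [t|z /norm1_re_im h].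
  by have [d /qd_mx[]] := lax_psi_derive m n t.
split.
- exact/quat_SU2/lax_psi_unit.
- by rewrite (lax_psi_twist m n h) quat_twist.
- by rewrite (laxU_quat m n h) -quatM (lax_psi_m m n h).
- by rewrite (laxV_quat m n h) -quatM (lax_psi_n m n h).
Qed.

Lemma lax_net_S m n : quat (S m n) = invmx (quat (lax_psi m n (cis g))) *m
   quat (mkq cg 0 0 sg) *m quat (lax_psi m n (cis (- g))).
Proof.
have [pp qq hS _] := spin_netP m n; rewrite -/(p m n) -/(q m n) in pp qq hS.
rewrite lax_psi_p lax_psi_q invmx_quat // -hS -!quatM; congr quat.
by rewrite unit_mulK // unit_mulVKr.
Qed.

Lemma lax_net_N m n : quat (N m n) = - (invmx (quat (lax_psi m n (cis g))) *m
   quat (Qk R) *m quat (mkq cg 0 0 sg) *m quat (lax_psi m n (cis (- g)))).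
Proof.
have [pp qq _ hN] := spin_netP m n; rewrite -/(p m n) -/(q m n) in pp qq hN.
rewrite lax_psi_p lax_psi_q invmx_quat // -!quatM -quatN; congr quat.
rewrite -[qmul (qmul _ _) (mkq _ _ _ _)]qmulA.
have -> : qmul (Qk R) (mkq cg 0 0 sg) = mkq (- sg) 0 0 cg by rewrite /Qk; qring.
by rewrite -[mkq _ _ _ _]opprK -hN qmulNr qmulNl opprK unit_mulK // unit_mulVKr.
Qed.

End LaxNet.

(** * Lax pairs of nets of constant mean curvature *)

Section LaxRepresentation.
Variable R : realType.
Local Notation E4 := 'rV[R]_4.
Local Notation net := (int -> int -> E4).

(* [n - k] conjugates the unit imaginary quaternion [n] into [- k]. *)
Lemma conj_to_Nk (n : E4) : dot n n = 1 -> qw n = 0 ->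
  exists p, dot p p = 1 /\ qmul p (qmul n (qconj p)) = - Qk R.
Proof.
move=> nn n0; have [nk|/eqP nk] := eqVneq (n - Qk R) 0.
  exists (Qi R); rewrite (_ : n = Qk R); last by apply/eqP; rewrite -subr_eq0 nk.
  by split; rewrite /Qi /Qk; [qexp; ring|qring].
exists (qdir (n - Qk R)); have u := dot_qdir nk; split=> //.
have nn2 : qmul n n = - q1 R.
  rewrite -[q1 R]scale1r -nn -qmul_conj -qmulNr; congr (qmul _ _).
  by apply: q_ext; rewrite /qconj ?qE ?n0 ?oppr0 ?opprK.
have e : qmul (n - Qk R) n = qmul (- Qk R) (n - Qk R).
  rewrite qmulDl nn2 qmulDr addrC; congr (_ + _).
  by rewrite /Qk /q1; qring.
rewrite qmulA {1}/qdir qmulZl e -qmulZr -qmulA -/(qdir (n - Qk R)).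
by rewrite qmul_conj u scale1r qmulq1.
Qed.

(** As N is orthogonal to S, N conj(S) is an imaginary unit; p turns it into - k, and q is then
    forced by p S conj(q) = M. *)
Lemma spin_frame_exists (cg sg : R) (S N : E4) : cg ^+ 2 + sg ^+ 2 = 1 ->
  dot S S = 1 -> dot N N = 1 -> dot S N = 0 ->
  exists p q, spin_frame cg sg S N (p, q).
Proof.
move=> cs SS NN SN.
have [||p [pp pn]] := @conj_to_Nk (qmul N (qconj S)).
- by rewrite dot_qmul dot_conj SS NN mulr1.
- by rewrite -SN; qexp; ring.
set M := mkq cg 0 0 sg; have MM : dot M M = 1 by rewrite -cs /M; qexp; ring.
exists p, (qmul (qconj M) (qmul p S)); split=> //=.
- by rewrite !dot_qmul dot_conj MM pp SS !mulr1.
- rewrite !qconjM qconjK -!qmulA (qmulA S) qmul_conj SS scale1r qmul1.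
  by rewrite qmulA qmul_conj pp scale1r qmul1.
rewrite !qconjM qconjK -!qmulA (qmulA N) (qmulA _ (qconj p)) qmulA pn.
by rewrite /M /Qk; qring.
Qed.

(** An edge is a combination of the diagonals with non-zero coefficients; if it vanished, they would
    be parallel. *)
Lemma embedded_edges (F : net) m n : embedded_faces F ->
  dm F m n <> 0 /\ dn F m n <> 0.
Proof.
move=> /(_ m n) [np [s [t [s01 t01 e]]]].
have [e1 _ e3 _] := quad_edges e.
split=> h; apply: np.
  exists s, t; split; first by apply/orP; left; lra.
  by apply/eqP; rewrite -subr_eq0; apply/eqP; rewrite -h /dm e1.
exists s, (- (1 - t)); split; first by apply/orP; left; lra.
by apply/eqP; rewrite -subr_eq0 -scaleNr opprK; apply/eqP; rewrite -h /dn e3.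
Qed.

Lemma framed_netP (eps : R) (F N S : net) :
  (forall m n, [/\ dot (S m n) (S m n) = 1, dot (N m n) (N m n) = 1 &
                   dot (S m n) (N m n) = 0]) ->
  embedded_faces F -> edge_parallel F N ->
  (forall m n, [/\ dm S m n = eps *: dm F m n,
     2 * dot (S m n) (dm F m n) = - eps * dot (dm F m n) (dm F m n) &
     dm N m n = 0 -> dot (dm F m n) (N m n) = 0]) ->
  (forall m n, [/\ dn S m n = eps *: dn F m n,
     2 * dot (S m n) (dn F m n) = - eps * dot (dn F m n) (dn F m n) &
     dn N m n = 0 -> dot (dn F m n) (N m n) = 0]) ->
  framed_net eps F N S.
Proof.
move=> hu emb par hm hn; split=> // m n.
  have [f0 _] := embedded_edges m n emb; have [pm _] := par m n.
  have [dS SF g0] := hm m n; have [_ N1 _] := hu m n; have [_ N2 _] := hu (m + 1) n.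
  have [|dN NF] := edge_curvP f0 pm N1 _ g0; last by split.
  by rewrite (_ : N m n + dm N m n = N (m + 1) n) // /dm; qring.
have [_ f0] := embedded_edges m n emb; have [_ pn] := par m n.
have [dS SF g0] := hn m n; have [_ N1 _] := hu m n; have [_ N2 _] := hu m (n + 1).
have [|dN NF] := edge_curvP f0 pn N1 _ g0; last by split.
by rewrite (_ : N m n + dn N m n = N m (n + 1)) // /dn; qring.
Qed.

Lemma quat_Qk : quat (Qk R) = qk R.
Proof.
rewrite quatE /Qk /qk ?qE oppr0; congr mx2; apply: complex_ext => /=; ring.
Qed.

Lemma exp_qkE (t : R) : exp_qk t = quat (mkq (cos t) 0 0 (sin t)).
Proof.
rewrite /exp_qk -quat_Qk -quat1 -!quatZ -quatD; congr quat.
by rewrite /Qk /q1; qring.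
Qed.

Lemma lax_representation_S3 (H : R) (F N : net) :
  framed_net 1 F N F -> isothermic_net H F N -> signed_net H F N ->
  (forall m n (c : R), F (m + 1) n <> c *: cm_dual F N H m n /\
                       F m (n + 1) <> c *: cm_dual F N H m n) ->
  exists (L : lax_data R) (Phi : int -> int -> R[i] -> 'M[R[i]]_2),
    [/\ lax_pair L, frame L Phi & immersion_S3 H F N Phi].
Proof.
move=> fr iso sg off.
(* s is sin (arccot H), written so that positivity is visible. *)
pose g := arccot H / 2; pose s := cos (atan H).
have s0 : 0 < s by apply: cos_gt0_pihalf; rewrite atan_gtNpi2 atan_ltpi2.
have g2 : g + g = pi / 2 - atan H by rewrite /g /arccot; field.
have hs : 2 * (cos g * sin g) = s.
  transitivity (sin (g + g)); first by rewrite sinD; ring.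
  by rewrite g2 sinB sin_pihalf cos_pihalf mul1r mul0r subr0.
have hc : cos g ^+ 2 - sin g ^+ 2 = H * s.
  rewrite !expr2 -cosD g2 cosB cos_pihalf sin_pihalf mul0r add0r mul1r.
  by rewrite -{2}(atanK H) /tan divfK // gt_eqF.
have cs := cos2Dsin2 g.
have c0 : cos g != 0.
  by apply: contraTneq s0 => c0; rewrite -hs c0 mul0r mulr0 ltxx.
have sn0 : sin g != 0.
  by apply: contraTneq s0 => c0'; rewrite -hs c0' !mulr0 ltxx.
have [FF NN FN] := framed_unit fr 0 0.
have [p0 [q0 fr0]] := spin_frame_exists cs FF NN FN.
have [pp qq _ _] := fr0.
have [psi0 [u0 tw0 d0 ep eq]] := loop_through c0 sn0 pp qq.
have hs1 : 2 * (cos g * sin g) = 1 * s by rewrite mul1r.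
(* The excluded positions of the neighbour are s (N + H F) in the first direction and - s (N + H F)
   in the second. *)
have offd m n : dm F m n <> (H * s - 1) *: F m n + s *: N m n /\
                dn F m n <> - (H * s + 1) *: F m n - s *: N m n.
  split=> h.
    have [+ _] := off m n s; apply; rewrite /cm_dual.
    transitivity (F m n + dm F m n); first by rewrite /dm; qring.
    by rewrite h; qring.
  have [_ +] := off m n (- s); apply; rewrite /cm_dual.
  transitivity (F m n + dn F m n); first by rewrite /dn; qring.
  by rewrite h; qring.
have es : 1 * sin g = sin g by rewrite mul1r.
exists (lax_net_data H s F N p0 q0).
exists (fun m n z => quat (lax_psi H s F N p0 q0 psi0 m n z)); split.
- exact: (lax_net_pair es s0 cs hc hs1 fr iso sg offd fr0).
- exact: (lax_net_frame es s0 cs hc hs1 fr iso sg offd fr0 u0 tw0 d0).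
- move=> m n; rewrite -/g.
  have -> : exp_qk ((g - - g) / 2) = quat (mkq (cos g) 0 0 (sin g)).
    by rewrite exp_qkE opprK (_ : (g + g) / 2 = g) //; field.
  rewrite -quat_Qk; split.
    exact: (lax_net_S es s0 cs hc hs1 fr iso sg offd fr0 (erefl _) (erefl _) ep eq).
  exact: (lax_net_N es s0 cs hc hs1 fr iso sg offd fr0 (erefl _) (erefl _) ep eq).
Qed.

Lemma lax_representation_R3 (F N : net) :
  framed_net 0 F N (fun _ _ => q1 R) -> isothermic_net 1 F N ->
  signed_net 1 F N -> (forall m n, imaginary (F m n) /\ imaginary (N m n)) ->
  (forall m n, dm F m n <> N m n) ->
  exists (L : lax_data R) (Phi : int -> int -> R[i] -> 'M[R[i]]_2),
    [/\ lax_pair L, frame L Phi & immersion_R3 F N Phi].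
Proof.
move=> fr iso sg im off.
have es : 0 * 0 = 0 :> R by rewrite mul0r.
have cs : 1 ^+ 2 + 0 ^+ 2 = 1 :> R by ring.
have hc : 1 ^+ 2 - 0 ^+ 2 = 1 * 1 :> R by ring.
have hs : 2 * (1 * 0) = 0 * 1 :> R by ring.
have [FF NN FN] := framed_unit fr 0 0.
have [p0 [q0 fr0]] := spin_frame_exists cs FF NN FN.
have [/= pp qq hS _] := fr0.
have qpE : q0 = p0.
  move: hS; rewrite qmul1 -/(q1 R) => /(congr1 (fun z => qmul z q0)).
  by rewrite unit_mulVKr // qmul1.
have [Fim Nim] := im 0 0.
(* Chosen so that y p0 = - p0 (F + N/2), the derivative required of the frame; y is imaginary
   because F and N are. *)
pose y := - qmul p0 (qmul (F 0 0 + 2^-1 *: N 0 0) (qconj p0)).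
have y0 : qw y = 0.
  have -> : qw y = - (dot p0 p0 * qw (F 0 0 + 2^-1 *: N 0 0)).
    by rewrite /y; qexp; ring.
  by rewrite qE [qw (_ *: _)]qE /qw Fim Nim mulr0 addr0 mulr0 oppr0.
have [psi0 [u0 tw0 d0 ep dp]] := loop_tangent pp y0.
have eq : psi0 (cis (- 0)) = q0 by rewrite oppr0 ep qpE.
have dp0 : q_is_derive (fun x => psi0 (cis x)) 0
    (- qmul p0 (F 0 0 + 2^-1 *: N 0 0)).
  by move: dp; rewrite /y qmulNl qmulA unit_mulVKr.
have offd m n : dm F m n <> (1 * 1 - 1) *: q1 R + 1 *: N m n /\
                dn F m n <> - (1 * 1 + 1) *: q1 R - 1 *: N m n.
  split; first by rewrite mulr1 subrr scale0r add0r scale1r; exact: off.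
  have [Fi Ni] := im m n; have [Fi' _] := im m (n + 1).
  move/(congr1 (@qw R)); rewrite /dn /q1 ?qE /qw Fi Fi' Ni => h.
  by move: h; lra.
have c1 : 1 = cos 0 :> R by rewrite cos0.
have s1 : 0 = sin 0 :> R by rewrite sin0.
exists (lax_net_data 1 1 F N p0 q0).
exists (fun m n z => quat (lax_psi 1 1 F N p0 q0 psi0 m n z)); split.
- exact: (lax_net_pair es ltr01 cs hc hs fr iso sg offd fr0).
- exact: (lax_net_frame es ltr01 cs hc hs fr iso sg offd fr0 u0 tw0 d0).
move=> m n.
have hp := lax_psi_p es ltr01 cs hc hs fr iso sg offd fr0 c1 s1 ep m n.
have hd := lax_psi_derive0 es ltr01 cs hc hs fr iso sg offd fr0 c1 s1 d0 ep
  erefl erefl erefl (fun _ _ => erefl) dp0 m n.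
have hN := lax_net_N es ltr01 cs hc hs fr iso sg offd fr0 c1 s1 ep eq m n.
have [_ ->] := qd_mx hd; split.
  have c0 : cis (- 0) = cis 0 :> R[i] by rewrite oppr0.
  have q10 : quat (mkq 1 0 0 0) = 1%:M :> 'M[R[i]]_2 := quat1 R.
  rewrite hN c0 q10 quat_Qk.
  exact: (congr1 (fun A => - (A *m _)) (mulmx1 _)).
have [up _ _ _] := spin_netP fr iso fr0 m n.
rewrite hp invmx_quat // -quatM qmulNr unit_mulK // quatN opprK quatD quatZ.
by rewrite fmorphV rmorph_nat addrK.
Qed.

(** * Scaling to mean curvature 1 *)

Section Scaling.
Variables (F N : net) (H : R).
Hypothesis H0 : H != 0.
Let F' : net := fun m n => H *: F m n.

Lemma dm_scale m n : dm F' m n = H *: dm F m n.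
Proof. by rewrite /dm /F' scalerBr. Qed.

Lemma dn_scale m n : dn F' m n = H *: dn F m n.
Proof. by rewrite /dn /F' scalerBr. Qed.

Lemma parallel_scale (x y : E4) : parallel x y -> parallel (H *: x) y.
Proof.
move=> [a [b [ab e]]]; exists (a / H), b; rewrite scalerA divfK //.
by split=> //; rewrite mulf_eq0 invr_eq0 (negPf H0) orbF.
Qed.

Lemma edge_parallel_scale : edge_parallel F N -> edge_parallel F' N.
Proof.
move=> h m n; have [h1 h2] := h m n.
by rewrite dm_scale dn_scale; split; exact: parallel_scale.
Qed.

Lemma cmc_scale : const_mean_curvature F N H -> const_mean_curvature F' N 1.
Proof.
move=> cmc m n; have [e1 [e2 [on fF fN ar hH]]] := cmc m n.
have span x : in_span2 e1 e2 x -> in_span2 e1 e2 (H *: x).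
  by move=> [a [b ->]]; exists (H * a), (H * b); rewrite scalerDr !scalerA.
have arE : area e1 e2 F' m n = H ^+ 2 * area e1 e2 F m n.
  by rewrite /area /F' !dot_lin; ring.
have mxE : mixed_area e1 e2 F' N m n = H * mixed_area e1 e2 F N m n.
  by rewrite /mixed_area /area /F' !dot_lin; ring.
exists e1, e2; split=> //.
- by case: fF => h1 h2 h3; split; rewrite /F' -scalerBr; exact: span.
- by rewrite arE mulf_neq0 // expf_neq0.
have mE : mixed_area e1 e2 F N m n = - (H * area e1 e2 F m n).
  by rewrite [in RHS]hH divfK // opprK.
by rewrite mxE arE mE; field; rewrite ar H0.
Qed.

Lemma embedded_scale : embedded_faces F -> embedded_faces F'.
Proof.
move=> emb m n; have [np [s [t [s01 t01 e]]]] := emb m n; split.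
  move=> [a [b [ab h]]]; apply: np; exists a, b; split=> //.
  by apply: (scalerI H0); move: h; rewrite /F' -!scalerBr !scalerA ![H * _]mulrC.
exists s, t; split=> //; move/(congr1 (fun x => H *: x)): e.
by rewrite /F' !scalerDr !scalerA ![H * _]mulrC.
Qed.

End Scaling.

End LaxRepresentation.

Theorem theorem6 (R : realType) (F N : int -> int -> 'rV[R]_4) (H : R) :
  (* CMC nets in R^3; scaling F by H normalizes the mean curvature to 1 *)
  (qnet_R3 F N -> H <> 0 -> const_mean_curvature F N H ->
   embedded_faces F -> non_umbilic F N H -> edges_off_dual_R3 F N H ->
   exists (b : bool) (L : lax_data R) (Phi : int -> int -> R[i] -> 'M[R[i]]_2),
     [/\ lax_pair L, frame L Phi &
         immersion_R3 (transpose_if b (fun m n => H *: F m n)) (transpose_if b N)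
                      Phi])
  /\
  (* CMC (H <> 0) and minimal (H = 0) nets in S^3 *)
  (qnet_S3 F N -> const_mean_curvature F N H ->
   embedded_faces F -> non_umbilic F N H -> edges_off_dual_S3 F N H ->
   exists (b : bool) (L : lax_data R) (Phi : int -> int -> R[i] -> 'M[R[i]]_2),
     [/\ lax_pair L, frame L Phi &
         immersion_S3 H (transpose_if b F) (transpose_if b N) Phi]).
Proof.
split.
- move=> [im _ _ par ort] /eqP H0 cmc emb numb off.
  pose F' m n := H *: F m n.
  have im' m n : imaginary (F' m n) /\ imaginary (N m n).
    by have [hF hN _] := im m n; rewrite /imaginary mxE hF mulr0.
  have fr : framed_net 0 F' N (fun _ _ => q1 R).
    apply: framed_netP => [m n|||m n|m n].
    + have [_ hN NN] := im m n; split=> //; first by rewrite /q1; qexp; ring.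
      by rewrite /q1; qexp; rewrite /qw hN; ring.
    + exact: embedded_scale.
    + exact: edge_parallel_scale.
    + have [i1 _ _] := im m n; have [i2 _ _] := im (m + 1) n.
      rewrite {1}/dm subrr scale0r oppr0 mul0r; split=> //.
        by rewrite dm_scale /dm /q1; qexp; rewrite /qw i1 i2; ring.
      rewrite dm_scale dotZl => /(ort m n).1 ->; exact: mulr0.
    + have [i1 _ _] := im m n; have [i2 _ _] := im m (n + 1).
      rewrite {1}/dn subrr scale0r oppr0 mul0r; split=> //.
        by rewrite dn_scale /dn /q1; qexp; rewrite /qw i1 i2; ring.
      rewrite dn_scale dotZl => /(ort m n).2 ->; exact: mulr0.
  have cmc' := cmc_scale H0 cmc; have emb' := embedded_scale H0 emb.
  (* The net N + H F is unaffected by the normalization. *)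
  have numb' : non_umbilic F' N 1.
    by move=> h; apply: numb => m n; have := h m n; rewrite /cm_dual !scale1r.
  have off' m n : dm F' m n <> N m n /\ dn F' m n <> N m n.
    have [h1 h2] := off m n; split=> h; [apply: h1|apply: h2].
      by rewrite /cm_dual -h /dm /F' subrK.
    by rewrite /cm_dual -h /dn /F' subrK.
  have iso := cmc_isothermic fr cmc' emb' numb'.
  (* The sign of the dual factors decides whether the lattice directions must be exchanged. *)
  have [sg|sg] := cmc_signed fr cmc' emb' numb'; [exists false|exists true].
    apply: (lax_representation_R3 fr iso sg im') => m n.
    by have [] := off' m n.
  apply: (lax_representation_R3 (framed_transpose fr) (isothermic_transpose iso) sg).
    by move=> m n; exact: im'.
  by move=> m n; have [] := off' n m.
- move=> [un _ _ par] cmc emb numb off.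
  have fr : framed_net 1 F N F.
    apply: framed_netP => // m n.
    + have [F1 _ FN] := un m n; have [F2 _ FN2] := un (m + 1) n; split.
      * by rewrite scale1r.
      * by rewrite /dm !dot_lin F1 F2 (dotC (F (m + 1) n)); ring.
      (* A normal which is constant along the edge is orthogonal to F at both of its ends. *)
      * move=> /eqP; rewrite /dm subr_eq0 => /eqP e.
        by rewrite dotDl dotNl FN -e FN2 subr0.
    + have [F1 _ FN] := un m n; have [F2 _ FN2] := un m (n + 1); split.
      * by rewrite scale1r.
      * by rewrite /dn !dot_lin F1 F2 (dotC (F m (n + 1))); ring.
      * move=> /eqP; rewrite /dn subr_eq0 => /eqP e.
        by rewrite dotDl dotNl FN -e FN2 subr0.
  have iso := cmc_isothermic fr cmc emb numb.
  have [sg|sg] := cmc_signed fr cmc emb numb; [exists false|exists true].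
    exact: (lax_representation_S3 fr iso sg off).
  apply: (lax_representation_S3 (framed_transpose fr) (isothermic_transpose iso) sg).
  by move=> m n c; have [] := off n m c.
Qed.
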